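(* Let $d\ge2$, $a>0$, and for $N\ge1$ let $G_N(a,t)=\sum_{n=0}^N A_n^+(a)\,t^n$ with $t$-plane zeros $t_1,\dots,t_N$. For $-\pi\le\theta<\phi\le\pi$ let $\alpha_N(\theta,\phi)=\#\{k:\theta<\operatorname{Arg} t_k\le\phi\}$, where $\operatorname{Arg}$ is the principal argument. Then the arguments of the zeros of $G_N(a,t)$ approach a uniform distribution: for any $-\pi\le\theta<\phi\le\pi$ and $\epsilon>0$ there is $N_1$ such that for all $N\ge N_1$, \[ \left|\tfrac1N\alpha_N(\theta,\phi)-\tfrac{1}{2\pi}(\phi-\theta)\right|^2\le\epsilon. \]
   Context: Let $\mathbb{L}^d$ be the $d$-dimensional hypercubic lattice and $\mathbb{L}^d_+$ the half-lattice consisting of vertices with last coordinate $\ge 0$ (and the lattice edges between them); its boundary $\partial\mathbb{L}^d_+$ is the set of vertices with last coordinate $0$. A positive walk is a self-avoiding walk in $\mathbb{L}^d_+$ starting at the origin; its visits are its vertices other than the origin lying in $\partial\mathbb{L}^d_+$. Let $c_n^+(v)$ be the number of positive walks of length $n$ with exactly $v$ visits, and $A_n^+(a)=\sum_{v=0}^n c_n^+(v)a^v$. For $a>0$ the limit $\lim_{n\to\infty}\frac1n\log A_n^+(a)$ exists. *)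

(* Defs.v *)
From Stdlib Require Import Reals Lra ZArith List Bool.
From Coquelicot Require Import Coquelicot.
Import ListNotations.
Open Scope R_scope.


(* A vertex of L^d is a list of d integers; coordinate d-1 is the "last" one. *)
Definition vertex := list Z.

Definition origin (d : nat) : vertex := repeat 0%Z d.

Definition last_coord (d : nat) (v : vertex) : Z := nth (d - 1) v 0%Z.

(* A unit step: direction i (0 <= i < d), sign true = +e_i, false = -e_i. *)
Definition step := (nat * bool)%type.

Definition steps (d : nat) : list step :=
  flat_map (fun i => [(i, true); (i, false)]) (seq 0 d).

Definition addstep (v : vertex) (s : step) : vertex :=
  let (i, b) := s in
  firstn i v ++ [(nth i v 0%Z + (if b then 1 else -1))%Z] ++ skipn (S i) v.

Fixpoint walk_from (v : vertex) (ss : list step) : list vertex :=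
  v :: match ss with
       | [] => []
       | s :: ss' => walk_from (addstep v s) ss'
       end.

(* All step sequences of length n; they are in bijection with the
   nearest-neighbour walks of length n in L^d starting at the origin. *)
Fixpoint step_seqs (d n : nat) : list (list step) :=
  match n with
  | O => [[]]
  | S m => flat_map (fun s => map (cons s) (step_seqs d m)) (steps d)
  end.

Fixpoint veqb (v w : vertex) : bool :=
  match v, w with
  | [], [] => true
  | x :: v', y :: w' => andb (Z.eqb x y) (veqb v' w')
  | _, _ => false
  end.

Fixpoint uniqb (l : list vertex) : bool :=
  match l with
  | [] => true
  | x :: l' => andb (negb (existsb (veqb x) l')) (uniqb l')
  end.

Definition positive_walk (d : nat) (ss : list step) : bool :=
  let w := walk_from (origin d) ss in
  andb (uniqb w) (forallb (fun v => Z.leb 0 (last_coord d v)) w).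

Definition visits (d : nat) (ss : list step) : nat :=
  count_occ Nat.eq_dec
    (map (fun v => if Z.eqb (last_coord d v) 0 then 1%nat else 0%nat)
         (tl (walk_from (origin d) ss))) 1%nat.

Definition cplus (d n v : nat) : nat :=
  length (filter (fun ss => andb (positive_walk d ss) (Nat.eqb (visits d ss) v))
                 (step_seqs d n)).

Definition Aplus (d n : nat) (a : R) : R :=
  sum_f_R0 (fun v => INR (cplus d n v) * a ^ v) n.

Fixpoint Cpow (z : C) (n : nat) : C :=
  match n with O => RtoC 1 | S m => Cmult z (Cpow z m) end.

Fixpoint G (d : nat) (a : R) (N : nat) (t : C) : C :=
  match N with
  | O => RtoC (Aplus d 0 a)
  | S M => Cplus (G d a M t) (Cmult (RtoC (Aplus d N a)) (Cpow t N))
  end.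

Fixpoint Cprod_lin (ts : list C) (t : C) : C :=
  match ts with
  | [] => RtoC 1
  | z :: ts' => Cmult (Cminus t z) (Cprod_lin ts' t)
  end.

(** * Principal argument, with values in (-PI, PI] (for z <> 0) *)
Definition Arg (z : C) : R :=
  if Rle_dec 0 (Im z) then acos (Re z / Cmod z) else - acos (Re z / Cmod z).

Definition alpha (ts : list C) (theta phi : R) : nat :=
  length (filter (fun z => if Rlt_dec theta (Arg z) then
                             if Rle_dec (Arg z) phi then true else false
                           else false) ts).

(* Main.v *)
(** Unfolding a positive walk in the first coordinate (Hammersley-Welsh reflections) uses
    only [O(sqrt n)] reflections, so up to a factor [exp (o(n))] one may restrict to walks
    whose first coordinate is minimal at the start and maximal at the end. Gluing two such
    walks with the same final height, the second one mirrored and run backwards, gives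
    unfolded walks returning to the boundary; these concatenate freely, and Fekete's lemma
    yields [A_n = exp (gamma n + o(n))].

    Put [r = exp (- gamma)]. Moving the zeros [t_k] radially to the unit circle (Schur) gives
    [Q(z) = prod (z - exp (i Arg t_k))] with
    [|Q(z)|^2 <= (sum A_n r^n)^2 / (A_N r^N) = exp (o(N))] for [|z| = 1], hence
    [|Q| <= exp (o(N))] on [|z| = 1/2] as well. Integrating [log |Q|] on that circle against the
    nonnegative densities [1 - cos (m phi + c)] bounds the power sums of the [exp (i Arg t_k)]
    by [o(N)], and the Fejer kernel turns this into upper bounds for the number of arguments in
    an arc; the complementary arcs give the lower bound. All integrals over the circle are
    replaced by exact averages over equally spaced nodes. *)

Require Import Defs.
From Stdlib Require Import Reals Lra Lia ZArith List Bool.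
From Coquelicot Require Import Coquelicot.
(* Again, since Coquelicot shadows [Forall]. *)
From Stdlib Require Import List.
Import ListNotations.
Open Scope R_scope.

(** The growth estimate bounds [|Q|] only from above, and on the unit circle [log |Q|] is singular
    at the points to be counted. On radius 1/2 its Fourier series is explicit: the frequency [m]
    carries the [m]-th power sum with a factor of size [2^(-m) / m], and the mean is 0 because
    [|Q(0)| = 1]. A nonnegative density containing the frequency [m] therefore turns the one-sided
    bound into a bound for that power sum. The price is a factor [m 2^m], harmless because only
    frequencies below a fixed [n] are used and [N] is taken large last.

    Schur's quotient divides by the last coefficient, so the exponential order of [A_N] must be
    known for every [N], not along a subsequence. Reflections act on coordinate 0 and visits are
    read off the last coordinate; [d >= 2] separates the two, so unfolding keeps all heights and
    weights. Gluing inserts one step in coordinate 0, which puts the two pieces into disjoint slabs,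
    shifts the lengths by one and yields walks of every length. *)

(** * Finite sums over lists *)

Definition lsum {A : Type} (f : A -> R) (l : list A) : R :=
  fold_right (fun x s => f x + s) 0 l.

Lemma lsum_app {A} (f : A -> R) l1 l2 : lsum f (l1 ++ l2) = lsum f l1 + lsum f l2.
Proof. induction l1 as [|x l1 IH]; simpl; [lra|]. rewrite IH; lra. Qed.

Lemma lsum_ext {A} (f g : A -> R) l :
  (forall x, In x l -> f x = g x) -> lsum f l = lsum g l.
Proof.
  induction l as [|x l IH]; simpl; intros H; auto.
  rewrite H, IH; auto.
Qed.

Lemma lsum_le {A} (f g : A -> R) l :
  (forall x, In x l -> f x <= g x) -> lsum f l <= lsum g l.
Proof.
  induction l as [|x l IH]; simpl; intros H; [lra|].
  apply Rplus_le_compat; auto.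
Qed.

Lemma lsum_plus {A} (f g : A -> R) l :
  lsum (fun x => f x + g x) l = lsum f l + lsum g l.
Proof. induction l as [|x l IH]; simpl; [lra|]. rewrite IH; lra. Qed.

Lemma lsum_scal {A} (c : R) (f : A -> R) l :
  lsum (fun x => c * f x) l = c * lsum f l.
Proof. induction l as [|x l IH]; simpl; [lra|]. rewrite IH; lra. Qed.

Lemma lsum_const {A} (c : R) (l : list A) :
  lsum (fun _ => c) l = INR (length l) * c.
Proof.
  induction l as [|x l IH]; [simpl; lra|].
  simpl length; rewrite S_INR; simpl; rewrite IH; lra.
Qed.

Lemma lsum_nonneg {A} (f : A -> R) l :
  (forall x, In x l -> 0 <= f x) -> 0 <= lsum f l.
Proof.
  intros H; pose proof (lsum_le (fun _ => 0) f l H) as Hle.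
  rewrite lsum_const in Hle; lra.
Qed.

Lemma lsum_map {A B} (g : A -> B) (f : B -> R) l :
  lsum f (map g l) = lsum (fun x => f (g x)) l.
Proof. induction l as [|x l IH]; simpl; auto. now rewrite IH. Qed.

Lemma lsum_flat_map {A B} (g : A -> list B) (f : B -> R) l :
  lsum f (flat_map g l) = lsum (fun x => lsum f (g x)) l.
Proof. induction l as [|x l IH]; simpl; auto. now rewrite lsum_app, IH. Qed.

Lemma lsum_swap {A B} (f : A -> B -> R) l1 l2 :
  lsum (fun x => lsum (f x) l2) l1 = lsum (fun y => lsum (fun x => f x y) l1) l2.
Proof.
  induction l1 as [|x l1 IH]; simpl.
  - rewrite lsum_const; lra.
  - now rewrite IH, <- lsum_plus.
Qed.

Lemma lsum_filter {A} (p : A -> bool) (f : A -> R) l :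
  lsum f (filter p l) = lsum (fun x => if p x then f x else 0) l.
Proof.
  induction l as [|x l IH]; simpl; auto.
  destruct (p x); simpl; rewrite IH; lra.
Qed.

Lemma lsum_incl {A} (f : A -> R) l l' :
  (forall x, 0 <= f x) -> NoDup l -> incl l l' -> lsum f l <= lsum f l'.
Proof.
  intros Hf; revert l'; induction l as [|x l IH]; intros l' Hnd Hi.
  - apply lsum_nonneg; auto.
  - inversion Hnd as [|? ? Hx Hnd']; subst.
    destruct (in_split x l' (Hi x (or_introl eq_refl))) as (l1 & l2 & ->).
    assert (Hi' : incl l (l1 ++ l2)).
    { intros y Hy; specialize (Hi y (or_intror Hy)).
      apply in_app_or in Hi; apply in_or_app.
      destruct Hi as [|[->|]]; auto; contradiction. }
    specialize (IH _ Hnd' Hi'); rewrite lsum_app in *; simpl; lra.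
Qed.

Lemma lsum_seq_S (f : nat -> R) n :
  lsum f (seq 0 (S n)) = lsum f (seq 0 n) + f n.
Proof. rewrite seq_S, lsum_app; simpl; lra. Qed.

Lemma Rabs_lsum_le {A} (f : A -> R) l : Rabs (lsum f l) <= lsum (fun x => Rabs (f x)) l.
Proof.
  induction l as [|x l IH]; simpl; [rewrite Rabs_R0; lra|].
  eapply Rle_trans; [apply Rabs_triang|lra].
Qed.

Lemma lsum_indicator (f : nat -> R) k n :
  (k < n)%nat -> lsum (fun i => if Nat.eqb k i then f i else 0) (seq 0 n) = f k.
Proof.
  induction n as [|n IH]; intros Hk; [lia|].
  rewrite lsum_seq_S; destruct (Nat.eq_dec k n) as [->|Hn].
  - rewrite Nat.eqb_refl, (lsum_ext _ (fun _ => 0)), lsum_const; [lra|].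
    intros x Hx; apply in_seq in Hx.
    destruct (Nat.eqb_spec n x); [lia|auto].
  - rewrite IH by lia. destruct (Nat.eqb_spec k n); [lia|lra].
Qed.

Lemma lsum_sum_f_R0 (f : nat -> R) n : sum_f_R0 f n = lsum f (seq 0 (S n)).
Proof.
  induction n as [|n IH]; [simpl; lra|].
  simpl sum_f_R0; rewrite IH, (lsum_seq_S f (S n)); auto.
Qed.

Lemma lsum_pigeonhole {A} (f : A -> R) l :
  (0 < length l)%nat -> exists x, In x l /\ lsum f l <= INR (length l) * f x.
Proof.
  induction l as [|x l IH]; intros Hl; [simpl in Hl; lia|].
  destruct l as [|y l].
  - exists x; split; [now left|]. simpl; lra.
  - destruct IH as (z & Hz & Hle); [simpl; lia|].
    change (length (x :: y :: l)) with (S (length (y :: l))); rewrite S_INR.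
    change (lsum f (x :: y :: l)) with (f x + lsum f (y :: l)).
    pose proof (pos_INR (length (y :: l))).
    destruct (Rle_dec (f x) (f z)) as [Hxz|Hxz].
    + exists z; split; [now right|lra].
    + exists x; split; [now left|nra].
Qed.

(** Since [X] has no duplicates, it is enough to cover it by the lists [map (F k) Y], each of the
    same weight as [Y]. Only a decoder enters; an element may have several codes. *)
Lemma lsum_decode_le {A K} (wt : A -> R) (F : K -> A -> A) (X Y : list A) (codes : list K) :
  (forall x, 0 <= wt x) -> NoDup X -> (forall k y, In y Y -> wt (F k y) = wt y) ->
  (forall x, In x X -> exists k y, In k codes /\ In y Y /\ x = F k y) ->
  lsum wt X <= INR (length codes) * lsum wt Y.
Proof.
  intros Hwt Hnd HF Hsurj.
  rewrite <- lsum_const.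
  rewrite (lsum_ext _ (fun k => lsum wt (map (F k) Y))).
  - rewrite <- (lsum_flat_map (fun k => map (F k) Y)).
    apply lsum_incl; auto.
    intros x Hx; destruct (Hsurj x Hx) as (k & y & Hk & Hy & ->).
    apply in_flat_map; exists k; split; auto; now apply in_map.
  - intros k _; rewrite lsum_map; apply lsum_ext; intros; symmetry; auto.
Qed.

(** The images of all pairs form a duplicate-free list inside [Z]. In the applications [f] glues two
    walks and [c] is the weight of the origin of the second walk, which becomes a visit. *)
Lemma lsum_injective_product {A} (wt : A -> R) (f : A -> A -> A) (c : R) (X Y Z : list A) :
  (forall x, 0 <= wt x) -> NoDup X -> NoDup Y ->
  (forall x y, In x X -> In y Y -> In (f x y) Z /\ wt (f x y) = c * wt x * wt y) ->
  (forall x y x' y', In x X -> In y Y -> In x' X -> In y' Y ->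
     f x y = f x' y' -> x = x' /\ y = y') ->
  c * lsum wt X * lsum wt Y <= lsum wt Z.
Proof.
  intros Hwt HX HY Hf Hinj.
  apply Rle_trans with (lsum wt (flat_map (fun x => map (f x) Y) X)).
  - rewrite lsum_flat_map, (lsum_ext (fun x => lsum wt (map (f x) Y)) (fun x => c * lsum wt Y * wt x)).
    + rewrite lsum_scal; lra.
    + intros x Hx; rewrite lsum_map, (lsum_ext _ (fun y => c * wt x * wt y)).
      * rewrite lsum_scal; lra.
      * intros y Hy; now apply Hf.
  - apply lsum_incl; auto.
    + clear Hf. induction X as [|x X IH]; simpl; [constructor|].
      inversion HX as [|? ? Hx HX']; subst.
      apply NoDup_app.
      * apply NoDup_map_NoDup_ForallPairs; auto.
        intros y y' Hy Hy' E. now apply (Hinj x y x y') in E; [|now left|auto|now left|auto].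
      * apply IH; auto. intros; apply Hinj; auto; now right.
      * intros z Hz Hz'. apply in_map_iff in Hz as (y & <- & Hy).
        apply in_flat_map in Hz' as (x' & Hx' & Hz').
        apply in_map_iff in Hz' as (y' & E & Hy').
        apply Hinj in E; auto; [|now right|now left].
        destruct E; subst; contradiction.
    + intros z Hz; apply in_flat_map in Hz as (x & Hx & Hz).
      apply in_map_iff in Hz as (y & <- & Hy). now apply Hf.
Qed.

(** * Walks *)

Definition valid_steps (d : nat) (ss : list step) : Prop :=
  Forall (fun s => (fst s < d)%nat) ss.

Lemma in_steps d s : In s (steps d) <-> (fst s < d)%nat.
Proof.
  unfold steps; rewrite in_flat_map; split.
  - intros (i & Hi & Hs); apply in_seq in Hi.
    simpl in Hs; destruct Hs as [<-|[<-|[]]]; simpl; lia.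
  - destruct s as [i b]; simpl; intros Hi; exists i; split.
    + apply in_seq; lia.
    + destruct b; simpl; auto.
Qed.

Lemma NoDup_steps d : NoDup (steps d).
Proof.
  unfold steps; generalize 0%nat as m.
  induction d as [|d IH]; intros m; simpl; [constructor|].
  assert (Hm : forall b, ~ In (m, b)
    (flat_map (fun i => [(i, true); (i, false)]) (seq (S m) d))).
  { intros b H; apply in_flat_map in H as (i & Hi & H); apply in_seq in Hi.
    simpl in H; destruct H as [H|[H|[]]]; inversion H; lia. }
  constructor; [intros [H|H]; [discriminate|now apply Hm in H]|].
  constructor; auto.
Qed.

Lemma in_step_seqs d n ss :
  In ss (step_seqs d n) <-> length ss = n /\ valid_steps d ss.
Proof.
  revert ss; induction n as [|n IH]; intros ss; simpl.
  - split.
    + intros [<-|[]]; split; [auto|constructor].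
    + intros [H _]; destruct ss; [auto|discriminate].
  - rewrite in_flat_map; split.
    + intros (s & Hs & H); apply in_map_iff in H as (ss' & <- & H).
      apply IH in H as [H1 H2]; apply in_steps in Hs.
      split; [simpl; auto|constructor; auto].
    + intros [H1 H2]; destruct ss as [|s ss]; [discriminate|].
      inversion H2; subst; exists s; split; [now apply in_steps|].
      apply in_map, IH; auto.
Qed.

Lemma NoDup_step_seqs d n : NoDup (step_seqs d n).
Proof.
  induction n as [|n IH]; simpl; [repeat constructor; auto|].
  generalize (NoDup_steps d); generalize (steps d) as l.
  induction l as [|s l IHl]; intros Hl; simpl; [constructor|].
  inversion Hl as [|? ? Hs Hl']; subst.
  apply NoDup_app; auto.
  - apply NoDup_map_NoDup_ForallPairs; auto.
    intros x y _ _ E; now inversion E.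
  - intros z Hz Hz'; apply in_map_iff in Hz as (w & <- & _).
    apply in_flat_map in Hz' as (s' & Hs' & Hz').
    apply in_map_iff in Hz' as (w' & E & _); inversion E; subst; contradiction.
Qed.

Lemma length_steps d : length (steps d) = (2 * d)%nat.
Proof.
  unfold steps.
  assert (H : forall m, length (flat_map (fun i => [(i, true); (i, false)]) (seq m d)) = (2 * d)%nat);
    [|apply H].
  induction d as [|d IH]; intros m; [auto|].
  simpl seq; simpl flat_map; simpl length; rewrite IH; lia.
Qed.

Lemma length_step_seqs d n : length (step_seqs d n) = ((2 * d) ^ n)%nat.
Proof.
  induction n as [|n IH]; [auto|].
  simpl step_seqs; rewrite Nat.pow_succ_r', <- IH, <- (length_steps d).
  generalize (steps d) as l; intros l.
  induction l as [|s l IHl]; simpl; auto.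
  now rewrite length_app, length_map, IHl.
Qed.

Lemma addstep_length v i b :
  (i < length v)%nat -> length (addstep v (i, b)) = length v.
Proof.
  intros H; unfold addstep; rewrite !length_app, length_firstn, length_skipn.
  simpl; lia.
Qed.

Lemma addstep_nth v i b j :
  (i < length v)%nat ->
  nth j (addstep v (i, b)) 0%Z =
    (nth j v 0 + (if Nat.eqb i j then if b then 1 else -1 else 0))%Z.
Proof.
  revert i j; induction v as [|x v IH]; intros i j Hi; [simpl in Hi; lia|].
  destruct i as [|i]; destruct j as [|j].
  - simpl; reflexivity.
  - simpl; lia.
  - simpl; lia.
  - assert (Hi' : (i < length v)%nat) by (simpl in Hi; lia).
    specialize (IH i j Hi'); unfold addstep in *; simpl in *; exact IH.
Qed.

Definition endpoint (v : vertex) (ss : list step) : vertex := fold_left addstep ss v.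

Lemma walk_from_hd v ss : walk_from v ss = v :: tl (walk_from v ss).
Proof. destruct ss; reflexivity. Qed.

Lemma in_walk_from_start v ss : In v (walk_from v ss).
Proof. rewrite walk_from_hd; now left. Qed.

Lemma in_walk_from_end v ss : In (endpoint v ss) (walk_from v ss).
Proof.
  revert v; induction ss as [|s ss IH]; intros v; simpl; [now left|].
  right; apply IH.
Qed.

Lemma walk_from_app v s1 s2 :
  walk_from v (s1 ++ s2) = walk_from v s1 ++ tl (walk_from (endpoint v s1) s2).
Proof.
  revert v; induction s1 as [|s s1 IH]; intros v; simpl.
  - now rewrite walk_from_hd.
  - now rewrite IH.
Qed.

Lemma endpoint_app v s1 s2 : endpoint v (s1 ++ s2) = endpoint (endpoint v s1) s2.
Proof. unfold endpoint; apply fold_left_app. Qed.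

Lemma walk_from_vertex_length d v ss p :
  length v = d -> valid_steps d ss -> In p (walk_from v ss) -> length p = d.
Proof.
  revert v; induction ss as [|s ss IH]; intros v Hv Hss Hp.
  - destruct Hp as [<-|[]]; auto.
  - inversion Hss; subst.
    destruct Hp as [<-|Hp]; auto.
    apply (IH (addstep v s)); auto.
    destruct s; apply addstep_length; auto.
Qed.

Lemma endpoint_length d v ss :
  length v = d -> valid_steps d ss -> length (endpoint v ss) = d.
Proof. intros; eapply walk_from_vertex_length; eauto using in_walk_from_end. Qed.

Lemma length_walk_from v ss : length (walk_from v ss) = S (length ss).
Proof. revert v; induction ss as [|s ss IH]; intros v; simpl; auto. Qed.

(** * Lattice symmetries *)

(* The affine map sending [v] to [v'] and negating the coordinates selected by [sg]; [sym_step] is its linear part. *)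
Definition sym (d : nat) (sg : nat -> bool) (v v' p : vertex) : vertex :=
  map (fun j => ((if sg j then - (nth j p 0 - nth j v 0) else nth j p 0 - nth j v 0)
                 + nth j v' 0)%Z) (seq 0 d).

Definition sym_step (sg : nat -> bool) (s : step) : step :=
  (fst s, xorb (sg (fst s)) (snd s)).

Lemma sym_length d sg v v' p : length (sym d sg v v' p) = d.
Proof. unfold sym; now rewrite length_map, length_seq. Qed.

Lemma sym_nth d sg v v' p j : (j < d)%nat ->
  nth j (sym d sg v v' p) 0%Z =
   ((if sg j then - (nth j p 0 - nth j v 0) else nth j p 0 - nth j v 0) + nth j v' 0)%Z.
Proof.
  intros Hj; unfold sym.
  match goal with |- nth j (map ?f _) _ = _ =>
    rewrite (nth_indep _ 0%Z (f 0%nat)), (map_nth f), seq_nth by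
      (rewrite ?length_map, ?length_seq; auto) end.
  reflexivity.
Qed.

Lemma vertex_ext d (p q : vertex) : length p = d -> length q = d ->
  (forall j, (j < d)%nat -> nth j p 0%Z = nth j q 0%Z) -> p = q.
Proof.
  intros Hp Hq H; apply nth_ext with 0%Z 0%Z; [congruence|].
  intros j Hj; apply H; congruence.
Qed.

Lemma sym_base d sg v v' : length v' = d -> sym d sg v v' v = v'.
Proof.
  intros H; apply (vertex_ext d); auto using sym_length.
  intros j Hj; rewrite sym_nth by auto; destruct (sg j); lia.
Qed.

Lemma sym_inj d sg v v' p q : length p = d -> length q = d ->
  sym d sg v v' p = sym d sg v v' q -> p = q.
Proof.
  intros Hp Hq E; apply (vertex_ext d); auto; intros j Hj.
  assert (E' := f_equal (fun l => nth j l 0%Z) E); simpl in E'.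
  rewrite !sym_nth in E' by auto; destruct (sg j); lia.
Qed.

Lemma sym_addstep d sg v v' p s : length p = d -> (fst s < d)%nat ->
  sym d sg v v' (addstep p s) = addstep (sym d sg v v' p) (sym_step sg s).
Proof.
  intros Hp Hs; destruct s as [i b]; simpl in Hs; unfold sym_step; simpl fst; simpl snd.
  apply (vertex_ext d).
  - apply sym_length.
  - rewrite addstep_length; rewrite sym_length; auto.
  - intros j Hj; rewrite addstep_nth, !sym_nth, addstep_nth by (rewrite ?sym_length; lia).
    destruct (Nat.eqb_spec i j) as [->|]; destruct (sg j); destruct b; simpl; lia.
Qed.

Lemma sym_walk_from_gen d sg v v' p ss : length p = d -> valid_steps d ss ->
  walk_from (sym d sg v v' p) (map (sym_step sg) ss) = map (sym d sg v v') (walk_from p ss).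
Proof.
  revert p; induction ss as [|s ss IH]; intros p Hp Hss; [reflexivity|].
  inversion Hss as [|? ? Hs Hss']; subst; cbn [map walk_from]; f_equal.
  rewrite <- sym_addstep by auto; apply IH; auto.
  destruct s; apply addstep_length; auto.
Qed.

Lemma sym_walk_from d sg v v' ss : length v = d -> length v' = d -> valid_steps d ss ->
  walk_from v' (map (sym_step sg) ss) = map (sym d sg v v') (walk_from v ss).
Proof. intros; rewrite <- sym_walk_from_gen, sym_base; auto. Qed.

Lemma sym_endpoint d sg v v' ss : length v = d -> length v' = d -> valid_steps d ss ->
  endpoint v' (map (sym_step sg) ss) = sym d sg v v' (endpoint v ss).
Proof.
  intros Hv Hv' Hss.
  assert (H : forall p, length p = d ->
    endpoint (sym d sg v v' p) (map (sym_step sg) ss) = sym d sg v v' (endpoint p ss)).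
  { clear Hv Hv'; induction ss as [|s ss IH]; intros p Hp; [reflexivity|].
    inversion Hss as [|? ? Hs Hss']; subst; unfold endpoint in *; cbn [map fold_left].
    rewrite <- sym_addstep by auto; apply IH; auto.
    destruct s; apply addstep_length; auto. }
  rewrite <- H, sym_base; auto.
Qed.

Lemma sym_NoDup d sg v v' ss : length v = d -> length v' = d -> valid_steps d ss ->
  NoDup (walk_from v ss) -> NoDup (walk_from v' (map (sym_step sg) ss)).
Proof.
  intros Hv Hv' Hss H; rewrite (sym_walk_from d sg v v') by auto.
  apply NoDup_map_NoDup_ForallPairs; auto.
  intros p q Hp Hq; apply sym_inj.
  - apply (walk_from_vertex_length d v ss); auto.
  - apply (walk_from_vertex_length d v ss); auto.
Qed.

Lemma sym_valid d sg ss : valid_steps d ss -> valid_steps d (map (sym_step sg) ss).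
Proof. intros H; apply Forall_map; apply H. Qed.

(** With these patterns [sym] is a translation, a point reflection or a reflection in coordinate 0.
    Backwards traversal negates every step, hence [all_signs] in [reverse_walk]. *)
Definition no_sign (_ : nat) : bool := false.
Definition all_signs (_ : nat) : bool := true.
Definition x_sign (j : nat) : bool := Nat.eqb j 0.

Definition flip_x (ss : list step) : list step := map (sym_step x_sign) ss.

Definition reverse_walk (ss : list step) : list step := rev (map (sym_step all_signs) ss).

Lemma map_no_sign ss : map (sym_step no_sign) ss = ss.
Proof.
  rewrite <- map_id; apply map_ext; intros [i b]; unfold sym_step; simpl.
  now destruct b.
Qed.

Lemma flip_x_involutive ss : flip_x (flip_x ss) = ss.
Proof.
  unfold flip_x; rewrite map_map, <- map_id; apply map_ext.
  intros [i b]; unfold sym_step; simpl; f_equal.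
  rewrite <- xorb_assoc, xorb_nilpotent; now destruct b.
Qed.

Lemma reverse_walk_involutive ss : reverse_walk (reverse_walk ss) = ss.
Proof.
  unfold reverse_walk; rewrite map_rev, rev_involutive, map_map, <- map_id; apply map_ext.
  intros [i b]; unfold sym_step; simpl; now destruct b.
Qed.

Lemma addstep_cancel d v s : length v = d -> (fst s < d)%nat ->
  addstep (addstep v s) (sym_step all_signs s) = v.
Proof.
  intros Hv Hs; destruct s as [i b]; simpl in Hs; unfold sym_step; simpl fst; simpl snd.
  assert (Hl : length (addstep v (i, b)) = d) by (rewrite addstep_length; lia).
  apply (vertex_ext d); auto.
  - rewrite addstep_length; lia.
  - intros j Hj; rewrite !addstep_nth by lia.
    destruct (Nat.eqb i j); destruct b; simpl; lia.
Qed.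

Lemma reverse_walk_valid d ss : valid_steps d ss -> valid_steps d (reverse_walk ss).
Proof. intros H; apply Forall_rev, sym_valid, H. Qed.

Lemma reverse_walk_from d v ss : length v = d -> valid_steps d ss ->
  walk_from (endpoint v ss) (reverse_walk ss) = rev (walk_from v ss) /\
  endpoint (endpoint v ss) (reverse_walk ss) = v.
Proof.
  revert v; induction ss as [|s ss IH]; intros v Hv Hss; [split; reflexivity|].
  inversion Hss as [|? ? Hs Hss']; subst.
  destruct (IH (addstep v s)) as [H1 H2]; auto.
  { destruct s; apply addstep_length; auto. }
  unfold reverse_walk in *; simpl map; simpl rev.
  change (endpoint v (s :: ss)) with (endpoint (addstep v s) ss).
  rewrite walk_from_app, endpoint_app, H1, H2; simpl.
  split.
  - f_equal; f_equal; now apply (addstep_cancel (length v)).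
  - now apply (addstep_cancel (length v)).
Qed.

Lemma length_flip_x ss : length (flip_x ss) = length ss.
Proof. apply length_map. Qed.

Lemma length_reverse_walk ss : length (reverse_walk ss) = length ss.
Proof. unfold reverse_walk; now rewrite length_rev, length_map. Qed.

(** * Unfolding *)

Definition forget_x_sign (s : step) : step :=
  (fst s, if x_sign (fst s) then true else snd s).

(** The invariant of all reflections used below. It determines length and heights, hence visits, so
    weights are seen to be preserved without following the geometry of the unfolding. *)
Definition same_up_to_x (ss ss' : list step) : Prop :=
  map forget_x_sign ss = map forget_x_sign ss'.

Lemma same_up_to_x_flip ss : same_up_to_x (flip_x ss) ss.
Proof.
  unfold same_up_to_x, flip_x; rewrite map_map; apply map_ext.
  intros [i b]; unfold forget_x_sign, sym_step; simpl; f_equal.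
  destruct (x_sign i); auto; now destruct b.
Qed.

Lemma same_up_to_x_reverse ss ss' :
  same_up_to_x ss ss' -> same_up_to_x (reverse_walk ss) (reverse_walk ss').
Proof.
  unfold same_up_to_x, reverse_walk; rewrite !map_rev; intros H; f_equal.
  assert (E : forall l, map forget_x_sign (map (sym_step all_signs) l) =
    map (fun s => forget_x_sign (sym_step all_signs s)) (map forget_x_sign l)).
  { intros l; rewrite !map_map; apply map_ext.
    intros [i b]; unfold forget_x_sign, sym_step; simpl; f_equal.
    destruct (x_sign i); auto. }
  now rewrite !E, H.
Qed.

Lemma same_up_to_x_app s1 s1' s2 s2' :
  same_up_to_x s1 s1' -> same_up_to_x s2 s2' -> same_up_to_x (s1 ++ s2) (s1' ++ s2').
Proof. unfold same_up_to_x; rewrite !map_app; congruence. Qed.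

Lemma same_up_to_x_length ss ss' : same_up_to_x ss ss' -> length ss = length ss'.
Proof. intros H; apply (f_equal (@length _)) in H; now rewrite !length_map in H. Qed.

Lemma same_up_to_x_valid d ss ss' :
  same_up_to_x ss ss' -> valid_steps d ss' -> valid_steps d ss.
Proof.
  revert ss'; induction ss as [|s ss IH]; intros ss' H H'; [constructor|].
  destruct ss' as [|s' ss']; [discriminate|].
  inversion H; inversion H'; subst; constructor; [congruence|].
  apply (IH ss'); auto.
Qed.

(** The two walks differ only in signs along coordinate 0, and [2 <= d] makes the last coordinate a
    different one. *)
Lemma same_up_to_x_heights d v v' ss ss' : (2 <= d)%nat ->
  length v = d -> length v' = d -> valid_steps d ss ->
  last_coord d v = last_coord d v' -> same_up_to_x ss ss' ->
  map (last_coord d) (walk_from v ss) = map (last_coord d) (walk_from v' ss').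
Proof.
  intros Hd; revert v v' ss'.
  induction ss as [|s ss IH]; intros v v' ss' Hv Hv' Hss Hl H;
    destruct ss' as [|s' ss']; try discriminate.
  - simpl; congruence.
  - inversion Hss as [|? ? Hs Hss']; subst.
    destruct s as [i b], s' as [i' b'].
    inversion H as [[E1 E2 E3]]; subst i'; simpl in Hs.
    cbn [map walk_from]; f_equal; auto.
    apply IH; auto.
    + apply addstep_length; auto.
    + rewrite addstep_length; lia.
    + unfold last_coord in *; rewrite !addstep_nth by lia; rewrite Hl.
      destruct (Nat.eqb_spec i (length v - 1)) as [->|]; auto.
      unfold x_sign in E2; simpl in E2.
      destruct (Nat.eqb_spec (length v - 1) 0); [lia|]. simpl in E2; subst; auto.
Qed.

(* The inverse of a sequence of reflections of suffixes: [ls] lists the distances between successive reflection points. *)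
Fixpoint refold (ls : list nat) (w : list step) : list step :=
  match ls with
  | [] => w
  | l :: ls' => firstn l w ++ flip_x (refold ls' (skipn l w))
  end.

Lemma refold_same_up_to_x ls w : same_up_to_x (refold ls w) w.
Proof.
  revert w; induction ls as [|l ls IH]; intros w; simpl; [reflexivity|].
  rewrite <- (firstn_skipn l w) at 3.
  apply same_up_to_x_app; [reflexivity|].
  unfold same_up_to_x; rewrite same_up_to_x_flip; apply IH.
Qed.

Definition xc (p : vertex) : Z := nth 0 p 0%Z.

Lemma last_maximum (f : vertex -> Z) v ss : exists s1 s2, ss = s1 ++ s2 /\
  (forall p, In p (walk_from v s1) -> (f p <= f (endpoint v s1))%Z) /\
  (forall p, In p (tl (walk_from (endpoint v s1) s2)) -> (f p < f (endpoint v s1))%Z).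
Proof.
  revert v; induction ss as [|s ss IH]; intros v.
  - exists [], []; repeat split; simpl; [|contradiction].
    intros p [<-|[]]; simpl; lia.
  - destruct (IH (addstep v s)) as (s1 & s2 & -> & H1 & H2).
    destruct (Z_le_gt_dec (f v) (f (endpoint (addstep v s) s1))) as [Hle|Hgt].
    + exists (s :: s1), s2; repeat split; auto.
      intros p [<-|Hp]; [exact Hle|now apply H1].
    + exists [], (s :: s1 ++ s2); repeat split; simpl.
      * intros p [<-|[]]; lia.
      * intros p Hp; rewrite walk_from_app in Hp; apply in_app_or in Hp as [Hp|Hp].
        -- specialize (H1 p Hp); lia.
        -- specialize (H2 p Hp); lia.
Qed.

Lemma coord_endpoint_le d j v ss : length v = d -> valid_steps d ss ->
  (nth j (endpoint v ss) 0 <= nth j v 0 + Z.of_nat (length ss))%Z.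
Proof.
  revert v; induction ss as [|s ss IH]; intros v Hv Hss; [simpl; lia|].
  inversion Hss as [|? ? Hs Hss']; subst; destruct s as [i b]; simpl in Hs.
  assert (H := IH (addstep v (i, b))); rewrite addstep_length in H by lia.
  specialize (H eq_refl Hss').
  change (endpoint v ((i, b) :: ss)) with (endpoint (addstep v (i, b)) ss).
  rewrite addstep_nth in H by lia.
  cbn [length]; destruct (Nat.eqb i j), b; lia.
Qed.

Lemma walk_from_app_NoDup (f : vertex -> Z) v s1 s2 :
  NoDup (walk_from v s1) -> NoDup (walk_from (endpoint v s1) s2) ->
  (forall p, In p (walk_from v s1) -> (f p <= f (endpoint v s1))%Z) ->
  (forall p, In p (tl (walk_from (endpoint v s1) s2)) -> (f (endpoint v s1) < f p)%Z) ->
  NoDup (walk_from v (s1 ++ s2)).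
Proof.
  intros H1 H2 H3 H4; rewrite walk_from_app; apply NoDup_app; auto.
  - rewrite walk_from_hd in H2; now inversion H2.
  - intros p Hp Hp'; specialize (H3 p Hp); specialize (H4 p Hp'); lia.
Qed.

Lemma walk_from_app_NoDup_inv v s1 s2 : NoDup (walk_from v (s1 ++ s2)) ->
  NoDup (walk_from v s1) /\ NoDup (walk_from (endpoint v s1) s2).
Proof.
  intros H; rewrite walk_from_app in H.
  split; [now apply NoDup_app_remove_r in H|].
  rewrite walk_from_hd; constructor.
  - intros Hin.
    assert (He := in_walk_from_end v s1).
    apply in_split in He as (l1 & l2 & E); rewrite E in H.
    rewrite <- app_assoc in H; apply NoDup_remove_2 in H; apply H.
    apply in_or_app; right; apply in_or_app; now right.
  - now apply NoDup_app_remove_l in H.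
Qed.

Lemma valid_steps_app d s1 s2 :
  valid_steps d (s1 ++ s2) <-> valid_steps d s1 /\ valid_steps d s2.
Proof. apply Forall_app. Qed.

Lemma xc_flip_walk d v ss p : (2 <= d)%nat -> length v = d -> valid_steps d ss ->
  In p (tl (walk_from v (flip_x ss))) ->
  exists q, In q (tl (walk_from v ss)) /\ (xc p = 2 * xc v - xc q)%Z.
Proof.
  intros Hd Hv Hss Hp; unfold flip_x in Hp.
  rewrite (sym_walk_from d x_sign v v) in Hp by auto.
  rewrite walk_from_hd in Hp; simpl in Hp.
  apply in_map_iff in Hp as (q & <- & Hq); exists q; split; auto.
  unfold xc; rewrite sym_nth by lia; change (x_sign 0) with true; cbv iota; lia.
Qed.

(* Hammersley-Welsh unfolding in coordinate 0: reflect the part after the last maximum, and iterate. The successive spans strictly decrease and sum to at most the length, hence the quadratic bound on the number of reflections. *)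
Lemma unfold_strict d ss v : (2 <= d)%nat -> length v = d -> valid_steps d ss ->
  NoDup (walk_from v ss) ->
  (forall p, In p (tl (walk_from v ss)) -> (xc v < xc p)%Z) ->
  exists ls ss', ss = refold ls ss' /\ NoDup (walk_from v ss') /\
    (forall p, In p (tl (walk_from v ss')) -> (xc v < xc p)%Z) /\
    (forall p, In p (walk_from v ss') -> (xc p <= xc (endpoint v ss'))%Z) /\
    (forall A : Z, (forall p, In p (walk_from v ss) -> (xc p <= xc v + A)%Z) ->
       (Z.of_nat (length ls) <= A)%Z) /\
    (length ls * S (length ls) <= 2 * length ss)%nat /\
    Forall (fun l => (l <= length ss)%nat) ls.
Proof.
  intros Hd.
  remember (length ss) as n eqn:En; revert ss v En.
  induction n as [n IH] using lt_wf_ind; intros ss v En Hv Hss Hnd Hpos.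
  destruct (last_maximum xc v ss) as (s1 & s2 & -> & H1 & H2).
  apply valid_steps_app in Hss as [Hs1 Hs2].
  pose proof (endpoint_length d v s1 Hv Hs1) as He.
  destruct (walk_from_app_NoDup_inv v s1 s2 Hnd) as [Hnd1 Hnd2].
  destruct s2 as [|s s2'].
  { exists [], (s1 ++ []); rewrite app_nil_r in *; repeat split; auto.
    - intros A HA; specialize (HA v (in_walk_from_start v s1)); simpl; lia.
    - simpl; lia. }
  set (s2 := s :: s2') in *; set (e := endpoint v s1) in *.
  assert (Hs1ne : s1 <> []).
  { intros ->; subst e; simpl in H2, Hpos.
    specialize (H2 (addstep v s) (in_walk_from_start _ _)).
    specialize (Hpos (addstep v s) (in_walk_from_start _ _)). simpl in H2; lia. }
  assert (Hev : (xc v < xc e)%Z).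
  { destruct s1 as [|t s1]; [congruence|].
    apply Hpos; rewrite walk_from_app; simpl; apply in_or_app; left.
    exact (in_walk_from_end (addstep v t) s1). }
  rewrite length_app in En.
  assert (Hl1 : (0 < length s1)%nat) by (destruct s1; [congruence|simpl; lia]).
  destruct (IH (length s2) ltac:(lia) (flip_x s2) e) as
    (ls & ss' & E & Hnd' & Hpos' & Hmax' & Hspan & Hk & Hls).
  - now rewrite length_flip_x.
  - auto.
  - now apply sym_valid.
  - now apply (sym_NoDup d x_sign e e).
  - intros p Hp; apply (xc_flip_walk d) in Hp as (q & Hq & ->); auto.
    specialize (H2 q Hq); lia.
  (* The suffix stays strictly right of [v], so its mirror image reaches at most [xc e - xc v - 1]
     beyond [e]; this bounds the number of later reflections. *)
  - assert (Hspan' : (Z.of_nat (length ls) <= xc e - xc v - 1)%Z).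
    { apply Hspan; intros p Hp; rewrite walk_from_hd in Hp; destruct Hp as [<-|Hp]; [lia|].
      apply (xc_flip_walk d) in Hp as (q & Hq & ->); auto.
      assert (Hvq : (xc v < xc q)%Z); [|lia].
      apply Hpos; rewrite walk_from_app.
      destruct s1 as [|t s1]; [congruence|]; simpl; apply in_or_app; now right. }
    pose proof (coord_endpoint_le d 0 v s1 Hv Hs1) as Hlip; fold e (xc e) (xc v) in Hlip.
    exists (length s1 :: ls), (s1 ++ ss'); repeat split.
    + simpl; rewrite firstn_app, skipn_app, Nat.sub_diag, firstn_all, skipn_all; simpl.
      rewrite app_nil_r; f_equal. now rewrite <- E, flip_x_involutive.
    + apply (walk_from_app_NoDup xc); auto.
    + intros p Hp; rewrite walk_from_app in Hp; fold e in Hp.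
      destruct s1 as [|t s1]; [congruence|]; simpl in Hp.
      apply in_app_or in Hp as [Hp|Hp].
      * apply Hpos; rewrite walk_from_app; simpl; apply in_or_app; now left.
      * specialize (Hpos' p Hp); lia.
    + rewrite endpoint_app; fold e; intros p Hp; rewrite walk_from_app in Hp.
      apply in_app_or in Hp as [Hp|Hp].
      * specialize (H1 p Hp); specialize (Hmax' e (in_walk_from_start _ _)); lia.
      * apply Hmax'; rewrite walk_from_hd; now right.
    + intros A HA; specialize (HA e); simpl length.
      assert (xc e <= xc v + A)%Z; [|lia].
      apply HA; rewrite walk_from_app; apply in_or_app; left; apply in_walk_from_end.
    (* With [k = length ls], the spans give [k + 1 <= length s1], and
       [(k + 1) (k + 2) = k (k + 1) + 2 (k + 1)] is at most [2 length s2 + 2 length s1]. *)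
    + simpl length; nia.
    + constructor; [lia|]. eapply Forall_impl; [|apply Hls]; cbv beta; intros; lia.
Qed.

(** The walk may return to the minimal value of [xc]. One reflection at the last maximum leaves a
    remainder satisfying the strict condition; this additional reflection shifts the quadratic bound
    to [pred k * k]. *)
Lemma unfold_weak d ss v : (2 <= d)%nat -> length v = d -> valid_steps d ss ->
  NoDup (walk_from v ss) ->
  (forall p, In p (walk_from v ss) -> (xc v <= xc p)%Z) ->
  exists ls ss', ss = refold ls ss' /\ NoDup (walk_from v ss') /\
    (forall p, In p (walk_from v ss') -> (xc v <= xc p <= xc (endpoint v ss'))%Z) /\
    (Nat.pred (length ls) * length ls <= 2 * length ss)%nat /\
    Forall (fun l => (l <= length ss)%nat) ls.
Proof.
  intros Hd Hv Hss Hnd Hpos.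
  destruct (last_maximum xc v ss) as (s1 & s2 & -> & H1 & H2).
  apply valid_steps_app in Hss as [Hs1 Hs2].
  pose proof (endpoint_length d v s1 Hv Hs1) as He.
  destruct (walk_from_app_NoDup_inv v s1 s2 Hnd) as [Hnd1 Hnd2].
  set (e := endpoint v s1) in *.
  destruct (unfold_strict d (flip_x s2) e) as
    (ls & ss' & E & Hnd' & Hpos' & Hmax' & _ & Hk & Hls); auto.
  - now apply sym_valid.
  - now apply (sym_NoDup d x_sign e e).
  - intros p Hp; apply (xc_flip_walk d) in Hp as (q & Hq & ->); auto.
    specialize (H2 q Hq); lia.
  - rewrite length_flip_x in *; rewrite length_app.
    assert (Hve : (xc v <= xc e)%Z) by (apply H1, in_walk_from_start).
    exists (length s1 :: ls), (s1 ++ ss'); repeat split.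
    + simpl; rewrite firstn_app, skipn_app, Nat.sub_diag, firstn_all, skipn_all; simpl.
      rewrite app_nil_r; f_equal. now rewrite <- E, flip_x_involutive.
    + apply (walk_from_app_NoDup xc); auto.
    + rewrite walk_from_app in H; apply in_app_or in H as [Hp|Hp].
      * apply Hpos; rewrite walk_from_app; apply in_or_app; now left.
      * specialize (Hpos' p Hp); lia.
    + rewrite endpoint_app; fold e; rewrite walk_from_app in H.
      apply in_app_or in H as [Hp|Hp].
      * specialize (H1 p Hp); specialize (Hmax' e (in_walk_from_start _ _)); lia.
      * apply Hmax'; rewrite walk_from_hd; now right.
    + simpl length; simpl Nat.pred; lia.
    + constructor; [lia|]. eapply Forall_impl; [|apply Hls]; cbv beta; intros; lia.
Qed.

(** A code holds the length of the part before the last minimum and the reflection distances of both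
    parts. The first part was unfolded backwards, hence the reversals around [refold]. *)
Definition decode (c : nat * (list nat * list nat)) (w : list step) : list step :=
  let '(m, (ls1, ls2)) := c in
  reverse_walk (refold ls1 (reverse_walk (flip_x (firstn m w)))) ++ refold ls2 (skipn m w).

Lemma decode_same_up_to_x c w : same_up_to_x (decode c w) w.
Proof.
  destruct c as [m [ls1 ls2]]; unfold decode.
  rewrite <- (firstn_skipn m w) at 3.
  apply same_up_to_x_app; [|apply refold_same_up_to_x].
  unfold same_up_to_x.
  rewrite (same_up_to_x_reverse _ _ (refold_same_up_to_x _ _)), reverse_walk_involutive.
  apply same_up_to_x_flip.
Qed.

(* Split at the last minimum; the second half is unfolded to the right, the reversed first half is unfolded to the right and then reflected to the left. *)
Lemma unfold_walk d ss v : (2 <= d)%nat -> length v = d -> valid_steps d ss ->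
  NoDup (walk_from v ss) ->
  exists m ls1 ls2 w, ss = decode (m, (ls1, ls2)) w /\ NoDup (walk_from v w) /\
    (forall p, In p (walk_from v w) -> (xc v <= xc p <= xc (endpoint v w))%Z) /\
    (m <= length ss)%nat /\
    (Nat.pred (length ls1) * length ls1 <= 2 * length ss)%nat /\
    (Nat.pred (length ls2) * length ls2 <= 2 * length ss)%nat /\
    Forall (fun l => (l <= length ss)%nat) ls1 /\ Forall (fun l => (l <= length ss)%nat) ls2.
Proof.
  intros Hd Hv Hss Hnd.
  destruct (last_maximum (fun p => - xc p)%Z v ss) as (s1 & s2 & -> & H1 & H2).
  apply valid_steps_app in Hss as [Hs1 Hs2].
  pose proof (endpoint_length d v s1 Hv Hs1) as He.
  destruct (walk_from_app_NoDup_inv v s1 s2 Hnd) as [Hnd1 Hnd2].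
  set (e := endpoint v s1) in *.
  destruct (unfold_strict d s2 e) as
    (ls2 & w2 & E2 & Hnd2' & Hpos2 & Hmax2 & _ & Hk2 & Hls2); auto.
  { intros p Hp; specialize (H2 p Hp); lia. }
  destruct (reverse_walk_from d v s1 Hv Hs1) as [Hr1 Hr2]; fold e in Hr1, Hr2.
  (* The reversed first half starts at a minimum of [xc] that it may attain again, so the weak
     version applies. *)
  destruct (unfold_weak d (reverse_walk s1) e) as
    (ls1 & r1 & E1 & Hndr & Hr & Hk1 & Hls1); auto.
  { now apply reverse_walk_valid. }
  { rewrite Hr1; now apply NoDup_rev. }
  { intros p Hp; rewrite Hr1 in Hp; apply in_rev in Hp; specialize (H1 p Hp); lia. }
  rewrite length_reverse_walk in *; rewrite length_app.
  assert (Hr1v : valid_steps d r1).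
  { apply same_up_to_x_valid with (reverse_walk s1); [|now apply reverse_walk_valid].
    symmetry; rewrite E1; apply refold_same_up_to_x. }
  assert (Hw2v : valid_steps d w2).
  { apply same_up_to_x_valid with s2; auto.
    symmetry; rewrite E2; apply refold_same_up_to_x. }
  assert (Hlr1 : length r1 = length s1).
  { rewrite <- (length_reverse_walk s1), E1; symmetry.
    apply same_up_to_x_length, refold_same_up_to_x. }
  (* [r1] runs rightwards from [e] to [f]. Backwards and mirrored it runs rightwards again, and it
     is placed so as to start at [v]. *)
  set (w1 := flip_x (reverse_walk r1)).
  assert (Hw1v : valid_steps d w1) by (now apply sym_valid, reverse_walk_valid).
  set (f := endpoint e r1) in *.
  assert (Hf : length f = d) by (now apply endpoint_length).
  destruct (reverse_walk_from d e r1 He Hr1v) as [Hq1 Hq2]; fold f in Hq1, Hq2.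
  assert (HW1 : walk_from v w1 = map (sym d x_sign f v) (rev (walk_from e r1))).
  { unfold w1, flip_x; rewrite (sym_walk_from d x_sign f v), Hq1; auto.
    now apply reverse_walk_valid. }
  assert (Hxs : forall p, xc (sym d x_sign f v p) = (xc v + xc f - xc p)%Z).
  { intros p; unfold xc; rewrite sym_nth by lia; change (x_sign 0) with true; cbv iota; lia. }
  assert (Hg : endpoint v w1 = sym d x_sign f v e).
  { unfold w1, flip_x; rewrite (sym_endpoint d x_sign f v), Hq2; auto.
    now apply reverse_walk_valid. }
  assert (Hgl : length (endpoint v w1) = d) by (rewrite Hg; apply sym_length).
  assert (Hx1 : forall p, In p (walk_from v w1) ->
    (xc v <= xc p <= xc (endpoint v w1))%Z).
  { intros p Hp; rewrite HW1 in Hp; apply in_map_iff in Hp as (q & <- & Hq).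
    apply in_rev in Hq; specialize (Hr q Hq); rewrite Hg, !Hxs; lia. }
  assert (HW2 : walk_from (endpoint v w1) w2 =
    map (sym d no_sign e (endpoint v w1)) (walk_from e w2)).
  { rewrite <- (map_no_sign w2) at 1; now apply sym_walk_from. }
  assert (Hx2 : forall p, xc (sym d no_sign e (endpoint v w1) p)
     = (xc p - xc e + xc (endpoint v w1))%Z).
  { intros p; unfold xc; rewrite sym_nth by lia; reflexivity. }
  assert (He2 : endpoint (endpoint v w1) w2 = sym d no_sign e (endpoint v w1) (endpoint e w2)).
  { rewrite <- (map_no_sign w2) at 1; now apply sym_endpoint. }
  assert (Hpos2' : forall p, In p (tl (walk_from (endpoint v w1) w2)) ->
    (xc (endpoint v w1) < xc p <= xc (endpoint (endpoint v w1) w2))%Z).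
  { intros p Hp; rewrite HW2, (walk_from_hd e) in Hp; simpl in Hp.
    apply in_map_iff in Hp as (q & <- & Hq).
    rewrite He2, !Hx2; specialize (Hpos2 q Hq).
    specialize (Hmax2 q); rewrite walk_from_hd in Hmax2; specialize (Hmax2 (or_intror Hq)).
    lia. }
  assert (Hends : (xc (endpoint v w1) <= xc (endpoint (endpoint v w1) w2))%Z).
  { rewrite He2, Hx2; specialize (Hmax2 e (in_walk_from_start _ _)); lia. }
  exists (length s1), ls1, ls2, (w1 ++ w2).
  assert (Hlw1 : length w1 = length s1).
  { unfold w1; now rewrite length_flip_x, length_reverse_walk. }
  repeat split; try (eapply Forall_impl; [|eassumption]; cbv beta; intros; lia); try lia.
  - unfold decode; rewrite firstn_app, skipn_app, Hlw1, Nat.sub_diag, <- Hlw1, firstn_all, skipn_all.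
    simpl; rewrite app_nil_r, <- E2; f_equal.
    unfold w1; rewrite flip_x_involutive, reverse_walk_involutive, <- E1.
    now rewrite reverse_walk_involutive.
  - apply (walk_from_app_NoDup xc).
    + rewrite HW1, <- Hq1, <- (sym_walk_from d x_sign f v); auto;
        [|now apply reverse_walk_valid].
      apply (sym_NoDup d x_sign f v); auto; [now apply reverse_walk_valid|].
      rewrite Hq1; now apply NoDup_rev.
    + rewrite <- (map_no_sign w2); now apply (sym_NoDup d no_sign e).
    + intros p Hp; now apply Hx1.
    + intros p Hp; now apply Hpos2'.
  - rewrite walk_from_app in H; apply in_app_or in H as [Hp|Hp].
    + now apply Hx1.
    + specialize (Hpos2' p Hp). specialize (Hx1 v (in_walk_from_start _ _)); lia.
  - rewrite endpoint_app; rewrite walk_from_app in H; apply in_app_or in H as [Hp|Hp].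
    + specialize (Hx1 p Hp); lia.
    + specialize (Hpos2' p Hp); lia.
Qed.

(** * Weighted counts of walks *)

Lemma veqb_eq v w : veqb v w = true <-> v = w.
Proof.
  revert w; induction v as [|x v IH]; intros [|y w]; simpl; try (split; congruence).
  rewrite andb_true_iff, Z.eqb_eq, IH; split; [intros []; congruence|].
  intros E; inversion E; auto.
Qed.

Lemma uniqb_NoDup l : uniqb l = true <-> NoDup l.
Proof.
  induction l as [|x l IH]; simpl; [split; [constructor|auto]|].
  rewrite andb_true_iff, negb_true_iff, IH.
  assert (E : existsb (veqb x) l = false <-> ~ In x l).
  { rewrite <- not_true_iff_false, existsb_exists; split; intros H H'; apply H.
    - exists x; split; [auto|now apply veqb_eq].
    - destruct H' as (y & Hy & E); apply veqb_eq in E; now subst. }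
  rewrite E; split; [intros []; now constructor|].
  intros H; now inversion H.
Qed.

Lemma positive_walk_spec d ss : positive_walk d ss = true <->
  NoDup (walk_from (origin d) ss) /\
  (forall p, In p (walk_from (origin d) ss) -> (0 <= last_coord d p)%Z).
Proof.
  unfold positive_walk; rewrite andb_true_iff, uniqb_NoDup, forallb_forall.
  split; intros [H1 H2]; split; auto; intros p Hp; specialize (H2 p Hp); now apply Z.leb_le.
Qed.

Lemma origin_length d : length (origin d) = d.
Proof. apply repeat_length. Qed.

Lemma origin_nth d j : nth j (origin d) 0%Z = 0%Z.
Proof. apply nth_repeat. Qed.

(** Unlike [visits] this includes the initial vertex, which makes it additive under concatenation
    and invariant under reversal. *)
Definition boundary_count (d : nat) (l : list vertex) : nat :=
  count_occ Z.eq_dec (map (last_coord d) l) 0%Z.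

Lemma boundary_count_visits d ss :
  boundary_count d (walk_from (origin d) ss) = S (visits d ss).
Proof.
  rewrite walk_from_hd; unfold boundary_count, visits; simpl map.
  rewrite count_occ_cons_eq by (unfold last_coord; apply origin_nth); f_equal.
  induction (tl (walk_from (origin d) ss)) as [|p l IH]; [reflexivity|].
  cbn [map count_occ]; rewrite IH.
  destruct (Z.eqb_spec (last_coord d p) 0) as [E|E], (Z.eq_dec (last_coord d p) 0);
    try contradiction; reflexivity.
Qed.

Lemma visits_le d ss : (visits d ss <= length ss)%nat.
Proof.
  apply le_S_n; rewrite <- boundary_count_visits; unfold boundary_count.
  rewrite <- (length_walk_from (origin d)), <- (length_map (last_coord d)).
  apply count_occ_bound.
Qed.

Definition positive_walks (d n : nat) : list (list step) :=
  filter (positive_walk d) (step_seqs d n).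

Definition weight (d : nat) (a : R) (ss : list step) : R := a ^ visits d ss.

Lemma weight_pos d a ss : 0 < a -> 0 < weight d a ss.
Proof. intros; now apply pow_lt. Qed.

(** Each walk is counted at the single index [visits d ss], which is within range because it is at
    most the length. *)
Lemma Aplus_lsum d n a : Aplus d n a = lsum (weight d a) (positive_walks d n).
Proof.
  unfold Aplus; rewrite lsum_sum_f_R0.
  rewrite (lsum_ext _ (fun v => lsum (fun ss =>
    if positive_walk d ss then if Nat.eqb (visits d ss) v then a ^ v else 0 else 0)
     (step_seqs d n))).
  - rewrite lsum_swap; unfold positive_walks; rewrite lsum_filter; apply lsum_ext.
    intros ss Hss; destruct (positive_walk d ss).
    + rewrite (lsum_indicator (fun v => a ^ v)); auto.
      apply in_step_seqs in Hss as [<- _]; pose proof (visits_le d ss); lia.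
    + rewrite lsum_const; lra.
  - intros v _; unfold cplus; rewrite <- lsum_const, lsum_filter; apply lsum_ext.
    intros ss _; destruct (positive_walk d ss); reflexivity.
Qed.

(** A crude bound that makes the supremum in Fekete's lemma finite. *)
Lemma Aplus_upper d n a : 0 < a -> Aplus d n a <= (INR (2 * d) * Rmax 1 a) ^ n.
Proof.
  intros Ha; rewrite Aplus_lsum.
  apply Rle_trans with (lsum (weight d a) (step_seqs d n)).
  - apply lsum_incl.
    + intros; apply Rlt_le, weight_pos; auto.
    + apply NoDup_filter, NoDup_step_seqs.
    + apply incl_filter.
  - apply Rle_trans with (lsum (fun _ => Rmax 1 a ^ n) (step_seqs d n)).
    + apply lsum_le; intros ss Hss; apply in_step_seqs in Hss as [<- _].
      unfold weight; apply Rle_trans with (Rmax 1 a ^ visits d ss).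
      * apply pow_incr; split; [lra|apply Rmax_r].
      * apply Rle_pow; [apply Rmax_l|apply visits_le].
    + rewrite lsum_const, length_step_seqs, pow_INR, Rpow_mult_distr; lra.
Qed.

(** * Unfolded walks *)

Definition unfolded (d : nat) (ss : list step) : bool :=
  forallb (fun p => Z.leb 0 (xc p) && Z.leb (xc p) (xc (endpoint (origin d) ss)))
    (walk_from (origin d) ss).

Definition end_height (d : nat) (ss : list step) : Z :=
  last_coord d (endpoint (origin d) ss).

Definition unfolded_walks (d n : nat) : list (list step) :=
  filter (unfolded d) (positive_walks d n).

Definition unfolded_walks_to (d n : nat) (h : Z) : list (list step) :=
  filter (fun ss => Z.eqb (end_height d ss) h) (unfolded_walks d n).

Lemma unfolded_spec d ss : unfolded d ss = true <->
  forall p, In p (walk_from (origin d) ss) ->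
    (0 <= xc p <= xc (endpoint (origin d) ss))%Z.
Proof.
  unfold unfolded; rewrite forallb_forall; split; intros H p Hp; specialize (H p Hp).
  - apply andb_true_iff in H as [H1 H2]; apply Z.leb_le in H1, H2; lia.
  - apply andb_true_iff; split; apply Z.leb_le; lia.
Qed.

Lemma in_unfolded_walks_to d n h ss : In ss (unfolded_walks_to d n h) <->
  (length ss = n /\ valid_steps d ss) /\
  (NoDup (walk_from (origin d) ss) /\
   forall p, In p (walk_from (origin d) ss) -> (0 <= last_coord d p)%Z) /\
  (forall p, In p (walk_from (origin d) ss) ->
    (0 <= xc p <= xc (endpoint (origin d) ss))%Z) /\
  end_height d ss = h.
Proof.
  unfold unfolded_walks_to, unfolded_walks, positive_walks.
  rewrite !filter_In, in_step_seqs, positive_walk_spec, unfolded_spec, Z.eqb_eq.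
  tauto.
Qed.

Lemma NoDup_unfolded_walks_to d n h : NoDup (unfolded_walks_to d n h).
Proof. repeat apply NoDup_filter; apply NoDup_step_seqs. Qed.

(** * Counting the reflection codes *)

Fixpoint words (alphabet : list nat) (k : nat) : list (list nat) :=
  match k with
  | O => [[]]
  | S k' => flat_map (fun x => map (cons x) (words alphabet k')) alphabet
  end.

Lemma in_words alphabet w :
  Forall (fun x => In x alphabet) w -> In w (words alphabet (length w)).
Proof.
  induction w as [|x w IH]; intros H; simpl; [now left|].
  inversion H; subst; apply in_flat_map; exists x; split; auto.
  apply in_map; auto.
Qed.

Lemma length_words alphabet k : length (words alphabet k) = (length alphabet ^ k)%nat.
Proof.
  induction k as [|k IH]; [reflexivity|].
  simpl words; rewrite Nat.pow_succ_r', <- IH.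
  assert (H : forall l, length (flat_map (fun x => map (cons x) (words alphabet k)) l) =
    (length l * length (words alphabet k))%nat); [|apply H].
  intros l; induction l as [|x l IHl]; simpl; auto.
  now rewrite length_app, length_map, IHl.
Qed.

Definition short_words (alphabet : list nat) (k : nat) : list (list nat) :=
  flat_map (words alphabet) (seq 0 (S k)).

Lemma in_short_words alphabet k w : (length w <= k)%nat ->
  Forall (fun x => In x alphabet) w -> In w (short_words alphabet k).
Proof.
  intros Hl H; apply in_flat_map; exists (length w); split.
  - apply in_seq; lia.
  - now apply in_words.
Qed.

(** Induction on [k]: for [q] letters, [(q + 1)^k + q^(k + 1) <= (q + 1)^(k + 1)]. *)
Lemma length_short_words alphabet k :
  (length (short_words alphabet k) <= S (length alphabet) ^ k)%nat.
Proof.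
  unfold short_words; induction k as [|k IH]; [simpl; lia|].
  rewrite seq_S, flat_map_app, length_app; cbn [flat_map]; rewrite Nat.add_0_l.
  rewrite app_nil_r, length_words.
  rewrite (Nat.pow_succ_r' (S (length alphabet))), Nat.pow_succ_r'.
  assert (length alphabet ^ k <= S (length alphabet) ^ k)%nat by (apply Nat.pow_le_mono_l; lia).
  nia.
Qed.

Definition fold_bound (n : nat) : nat := S (Nat.sqrt (2 * n)).

Lemma fold_bound_spec n k : (Nat.pred k * k <= 2 * n)%nat -> (k <= fold_bound n)%nat.
Proof.
  intros H; unfold fold_bound.
  assert (Nat.pred k <= Nat.sqrt (2 * n))%nat by (apply Nat.sqrt_le_square; nia).
  lia.
Qed.

(** One factor [n + 2] covers the [n + 1] splitting indices; each of the two lists has at most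
    [fold_bound n] letters from [0, ..., n], hence at most [(n + 2) ^ fold_bound n] values. *)
Definition code_count (n : nat) : nat := ((n + 2) ^ (2 * fold_bound n + 1))%nat.

Lemma visits_same_up_to_x d ss ss' : (2 <= d)%nat -> valid_steps d ss ->
  same_up_to_x ss ss' -> visits d ss = visits d ss'.
Proof.
  intros Hd Hss H; apply Nat.succ_inj; rewrite <- !boundary_count_visits.
  unfold boundary_count.
  now rewrite (same_up_to_x_heights d _ (origin d) ss ss')
    by (auto using origin_length).
Qed.

Lemma Aplus_le_unfolded d n a : (2 <= d)%nat -> 0 < a ->
  Aplus d n a <= INR (code_count n) * lsum (weight d a) (unfolded_walks d n).
Proof.
  intros Hd Ha; rewrite Aplus_lsum.
  set (alphabet := seq 0 (S n)).
  set (codes := list_prod alphabet (list_prod (short_words alphabet (fold_bound n))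
                                         (short_words alphabet (fold_bound n)))).
  assert (Hal : forall l, Forall (fun x => (x <= n)%nat) l -> Forall (fun x => In x alphabet) l).
  { intros l; apply Forall_impl; intros x Hx; apply in_seq; lia. }
  apply Rle_trans with (INR (length codes) * lsum (weight d a) (unfolded_walks d n)).
  - apply lsum_decode_le with (F := decode).
    + intros; apply Rlt_le, weight_pos; auto.
    + apply NoDup_filter, NoDup_step_seqs.
    + intros c y Hy; unfold weight; f_equal.
      apply visits_same_up_to_x; auto using decode_same_up_to_x.
      apply same_up_to_x_valid with y; auto using decode_same_up_to_x.
      unfold unfolded_walks, positive_walks in Hy; rewrite !filter_In, in_step_seqs in Hy; tauto.
    + intros ss Hss; unfold positive_walks in Hss.
      rewrite filter_In, in_step_seqs, positive_walk_spec in Hss.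
      destruct Hss as [[Hn Hv] [Hnd Hpos]].
      destruct (unfold_walk d ss (origin d)) as
        (m & ls1 & ls2 & w & E & Hndw & Hx & Hm & Hk1 & Hk2 & Hl1 & Hl2);
        auto using origin_length.
      rewrite Hn in *.
      exists (m, (ls1, ls2)), w; split; [|split; auto].
      * apply in_prod; [apply in_seq; lia|].
        apply in_prod; apply in_short_words; auto using fold_bound_spec.
      * assert (Hsame : same_up_to_x w ss)
          by (symmetry; rewrite E; apply decode_same_up_to_x).
        assert (Hvw : valid_steps d w) by (now apply same_up_to_x_valid with ss).
        unfold unfolded_walks, positive_walks.
        rewrite !filter_In, in_step_seqs, positive_walk_spec, unfolded_spec.
        split; [split; [split|split]|]; auto.
        -- now rewrite (same_up_to_x_length _ _ Hsame).
        (* The unfolded walk has the same sequence of heights, so it stays in the half-lattice. *)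
        -- intros p Hp; apply (in_map (last_coord d)) in Hp.
           rewrite (same_up_to_x_heights d _ (origin d) w ss) in Hp
             by (auto using origin_length).
           apply in_map_iff in Hp as (q & <- & Hq); auto.
        -- intros p Hp; specialize (Hx p Hp); unfold xc in Hx at 1.
           rewrite origin_nth in Hx; exact Hx.
  - apply Rmult_le_compat_r.
    + apply lsum_nonneg; intros; apply Rlt_le, weight_pos; auto.
    + apply le_INR; unfold codes, code_count.
      rewrite !length_prod.
      pose proof (length_short_words alphabet (fold_bound n)) as H.
      unfold alphabet in *; rewrite length_seq in *.
      replace (S (S n)) with (n + 2)%nat in H by lia.
      rewrite Nat.pow_add_r, Nat.pow_1_r.
      replace (2 * fold_bound n)%nat with (fold_bound n + fold_bound n)%nat by lia.
      rewrite Nat.pow_add_r, Nat.mul_comm.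
      apply Nat.mul_le_mono; [now apply Nat.mul_le_mono|lia].
Qed.

(** A positive walk of length [n] ends at a height in [0, ..., n]. Fixing the heaviest height costs
    a factor [n + 1] and allows two walks to be glued end to end. *)
Lemma unfolded_pigeonhole d n a : (2 <= d)%nat -> 0 < a -> exists h,
  lsum (weight d a) (unfolded_walks d n)
    <= INR (S n) * lsum (weight d a) (unfolded_walks_to d n h).
Proof.
  intros Hd Ha.
  destruct (lsum_pigeonhole
    (fun h => lsum (weight d a) (unfolded_walks_to d n (Z.of_nat h))) (seq 0 (S n)))
    as (h & Hh & Hle); [rewrite length_seq; lia|].
  exists (Z.of_nat h); rewrite length_seq in Hle.
  eapply Rle_trans; [|apply Hle]; clear h Hh Hle.
  right; rewrite (lsum_ext (fun h => lsum _ (unfolded_walks_to d n (Z.of_nat h)))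
    (fun h => lsum (fun ss => if Nat.eqb (Z.to_nat (end_height d ss)) h
                     then weight d a ss else 0) (unfolded_walks d n))).
  - rewrite lsum_swap; apply lsum_ext; intros ss Hss.
    rewrite (lsum_indicator (fun _ => weight d a ss)); auto.
    unfold unfolded_walks, positive_walks in Hss.
    rewrite !filter_In, in_step_seqs in Hss; destruct Hss as [[[Hn Hv] _] _].
    pose proof (coord_endpoint_le d (d - 1) (origin d) ss (origin_length d) Hv) as H.
    rewrite origin_nth in H; unfold end_height, last_coord; lia.
  - intros h _; unfold unfolded_walks_to; rewrite lsum_filter; apply lsum_ext.
    intros ss Hss; unfold unfolded_walks, positive_walks in Hss.
    rewrite !filter_In, positive_walk_spec in Hss; destruct Hss as [[_ [_ Hp]] _].
    specialize (Hp _ (in_walk_from_end _ _)); fold (end_height d ss) in Hp.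
    destruct (Z.eqb_spec (end_height d ss) (Z.of_nat h)),
      (Nat.eqb_spec (Z.to_nat (end_height d ss)) h); auto; lia.
Qed.

(** * Gluing unfolded walks *)

Definition join (w1 w2 : list step) : list step := w1 ++ (0%nat, true) :: w2.

Definition next_x (d : nat) (w : list step) : vertex :=
  addstep (endpoint (origin d) w) (0%nat, true).

(** The second piece enters only through the vertices it traverses from [next_x d w1], so translated
    copies and mirrored reversed copies are both covered. Its first vertex now counts as a visit
    when on the boundary, hence [boundary_count]. *)
Lemma join_unfolded d n m h h' w1 w2 : (2 <= d)%nat ->
  In w1 (unfolded_walks_to d n h) -> length w2 = m -> valid_steps d w2 ->
  NoDup (walk_from (next_x d w1) w2) ->
  (forall p, In p (walk_from (next_x d w1) w2) -> (0 <= last_coord d p)%Z) ->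
  (forall p, In p (walk_from (next_x d w1) w2) ->
     (xc (next_x d w1) <= xc p <= xc (endpoint (next_x d w1) w2))%Z) ->
  last_coord d (endpoint (next_x d w1) w2) = h' ->
  In (join w1 w2) (unfolded_walks_to d (n + m + 1) h') /\
  visits d (join w1 w2) = (visits d w1 + boundary_count d (walk_from (next_x d w1) w2))%nat.
Proof.
  intros Hd H1 Hm Hv Hnd Hh Hx He.
  apply in_unfolded_walks_to in H1 as [[Hn Hv1] [[Hnd1 Hh1] [Hx1 _]]].
  assert (HW : walk_from (origin d) (join w1 w2) =
    walk_from (origin d) w1 ++ walk_from (next_x d w1) w2).
  { unfold join; rewrite walk_from_app; reflexivity. }
  assert (HE : endpoint (origin d) (join w1 w2) = endpoint (next_x d w1) w2).
  { unfold join; rewrite endpoint_app; reflexivity. }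
  assert (Hnx : xc (next_x d w1) = (xc (endpoint (origin d) w1) + 1)%Z).
  { unfold next_x, xc; rewrite addstep_nth; [reflexivity|].
    rewrite (endpoint_length d); auto using origin_length; lia. }
  split.
  - apply in_unfolded_walks_to; rewrite HW; unfold end_height; rewrite HE.
    repeat split; auto.
    + unfold join; rewrite length_app; simpl; lia.
    + apply Forall_app; split; auto; constructor; auto; simpl; lia.
    + apply NoDup_app; auto.
      intros p Hp Hp'; specialize (Hx1 p Hp); specialize (Hx p Hp'); lia.
    + intros p Hp; apply in_app_or in Hp as [Hp|Hp]; auto.
    + apply in_app_or in H as [Hp|Hp].
      * now apply Hx1.
      * specialize (Hx p Hp); specialize (Hx1 _ (in_walk_from_end _ _)); lia.
    + apply in_app_or in H as [Hp|Hp].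
      * specialize (Hx _ (in_walk_from_end _ _)); specialize (Hx1 p Hp); lia.
      * specialize (Hx p Hp); lia.
  - apply Nat.succ_inj; rewrite <- boundary_count_visits, HW.
    unfold boundary_count at 1; rewrite map_app, count_occ_app.
    change (boundary_count d (walk_from (origin d) w1) +
      boundary_count d (walk_from (next_x d w1) w2) =
      S (visits d w1 + boundary_count d (walk_from (next_x d w1) w2)))%nat.
    rewrite boundary_count_visits; lia.
Qed.

Lemma app_inj_length {A} (l1 l1' l2 l2' : list A) :
  length l1 = length l1' -> l1 ++ l2 = l1' ++ l2' -> l1 = l1' /\ l2 = l2'.
Proof.
  revert l1'; induction l1 as [|x l1 IH]; intros [|x' l1'] H E; try discriminate; auto.
  inversion E; subst; destruct (IH l1') as [-> ->]; auto.
Qed.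

Lemma join_inj w1 w2 w1' w2' : length w1 = length w1' ->
  join w1 w2 = join w1' w2' -> w1 = w1' /\ w2 = w2'.
Proof.
  intros Hl E; apply app_inj_length in E as [-> E]; auto; inversion E; auto.
Qed.

Lemma next_x_length d w : (2 <= d)%nat -> valid_steps d w -> length (next_x d w) = d.
Proof.
  intros Hd Hw; unfold next_x.
  assert (length (endpoint (origin d) w) = d) by (apply endpoint_length; auto using origin_length).
  rewrite addstep_length; lia.
Qed.

Lemma next_x_last_coord d w : (2 <= d)%nat -> valid_steps d w ->
  last_coord d (next_x d w) = end_height d w.
Proof.
  intros Hd Hw; unfold next_x, end_height, last_coord.
  assert (length (endpoint (origin d) w) = d) by (apply endpoint_length; auto using origin_length).
  rewrite addstep_nth by lia; destruct (Nat.eqb_spec 0 (d - 1)); lia.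
Qed.

(* Walk to height [h], step along the boundary direction, and run the mirror image of a second walk to height [h] backwards. *)
Lemma unfolded_to_loops d n h a : (2 <= d)%nat -> 0 < a ->
  a * lsum (weight d a) (unfolded_walks_to d n h) * lsum (weight d a) (unfolded_walks_to d n h)
   <= lsum (weight d a) (unfolded_walks_to d (n + n + 1) 0).
Proof.
  intros Hd Ha.
  apply lsum_injective_product with (f := fun w1 w2 => join w1 (flip_x (reverse_walk w2)));
    auto using NoDup_unfolded_walks_to.
  - intros; apply Rlt_le, weight_pos; auto.
  - intros w1 w2 H1 H2; assert (H1' := H1); assert (H2' := H2).
    apply in_unfolded_walks_to in H1' as [[Hn1 Hv1] [_ [_ Hh1]]].
    apply in_unfolded_walks_to in H2' as [[Hn2 Hv2] [[Hnd2 Hpos2] [Hx2 Hh2]]].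
    set (f := endpoint (origin d) w2) in *; set (e := next_x d w1).
    assert (Hf : length f = d) by (apply endpoint_length; auto using origin_length).
    assert (He : length e = d) by (now apply next_x_length).
    destruct (reverse_walk_from d (origin d) w2 (origin_length d) Hv2) as [HR HRe].
    fold f in HR, HRe.
    assert (Hvr := reverse_walk_valid d w2 Hv2).
    assert (HW : walk_from e (flip_x (reverse_walk w2)) =
      map (sym d x_sign f e) (rev (walk_from (origin d) w2))).
    { unfold flip_x; rewrite (sym_walk_from d x_sign f e), HR; auto. }
    assert (HE : endpoint e (flip_x (reverse_walk w2)) = sym d x_sign f e (origin d)).
    { unfold flip_x; rewrite (sym_endpoint d x_sign f e), HRe; auto. }
    (* Both [e] and [f] have height [h], so the symmetry taking [f] to [e] keeps all heights and the
       origin lands on the boundary. *)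
    assert (Hlast : forall p, last_coord d (sym d x_sign f e p) = last_coord d p).
    { intros p; unfold last_coord; rewrite sym_nth by lia.
      unfold x_sign; destruct (Nat.eqb_spec (d - 1) 0); [lia|].
      assert (E := next_x_last_coord d w1 Hd Hv1); fold e in E; unfold last_coord in E.
      rewrite E, Hh1, <- Hh2; unfold end_height, last_coord; fold f; lia. }
    assert (Hxs : forall p, xc (sym d x_sign f e p) = (xc e + xc f - xc p)%Z).
    { intros p; unfold xc; rewrite sym_nth by lia; change (x_sign 0) with true; cbv iota; lia. }
    destruct (join_unfolded d n n h 0%Z w1 (flip_x (reverse_walk w2))) as [Hin Hvis]; auto.
    + now rewrite length_flip_x, length_reverse_walk.
    + now apply sym_valid.
    + fold e; apply (sym_NoDup d x_sign f e); auto; rewrite HR; now apply NoDup_rev.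
    + fold e; rewrite HW; intros p Hp; apply in_map_iff in Hp as (q & <- & Hq).
      rewrite Hlast; apply in_rev in Hq; auto.
    + fold e; rewrite HW, HE; intros p Hp; apply in_map_iff in Hp as (q & <- & Hq).
      apply in_rev in Hq; specialize (Hx2 q Hq); rewrite !Hxs.
      assert (xc (origin d) = 0%Z) by apply origin_nth; lia.
    + fold e; rewrite HE, Hlast; apply origin_nth.
    + split; auto; unfold weight; rewrite Hvis; fold e; rewrite HW.
      unfold boundary_count; rewrite map_map, (map_ext _ (last_coord d)), map_rev, count_occ_rev by auto.
      fold (boundary_count d (walk_from (origin d) w2)); rewrite boundary_count_visits.
      rewrite pow_add; simpl; lra.
  - intros w1 w2 w1' w2' H1 H2 H1' H2' E.
    apply in_unfolded_walks_to in H1 as [[Hn1 _] _].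
    apply in_unfolded_walks_to in H1' as [[Hn1' _] _].
    apply join_inj in E as [-> E]; [|congruence]; split; auto.
    rewrite <- (reverse_walk_involutive w2), <- (reverse_walk_involutive w2').
    rewrite <- (flip_x_involutive (reverse_walk w2)), E, flip_x_involutive; auto.
Qed.

(** The first walk ends on the boundary, so the translated second walk keeps its heights; its origin
    becomes a visit and contributes the factor [a]. *)
Lemma loops_supermultiplicative d n m a : (2 <= d)%nat -> 0 < a ->
  a * lsum (weight d a) (unfolded_walks_to d n 0) * lsum (weight d a) (unfolded_walks_to d m 0)
   <= lsum (weight d a) (unfolded_walks_to d (n + m + 1) 0).
Proof.
  intros Hd Ha.
  apply lsum_injective_product with (f := join); auto using NoDup_unfolded_walks_to.
  - intros; apply Rlt_le, weight_pos; auto.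
  - intros w1 w2 H1 H2; assert (H1' := H1); assert (H2' := H2).
    apply in_unfolded_walks_to in H1' as [[Hn1 Hv1] [_ [_ Hh1]]].
    apply in_unfolded_walks_to in H2' as [[Hn2 Hv2] [[Hnd2 Hpos2] [Hx2 Hh2]]].
    set (e := next_x d w1).
    assert (He : length e = d) by (now apply next_x_length).
    assert (HW : walk_from e w2 = map (sym d no_sign (origin d) e) (walk_from (origin d) w2)).
    { rewrite <- (map_no_sign w2) at 1; apply sym_walk_from; auto using origin_length. }
    assert (HE : endpoint e w2 = sym d no_sign (origin d) e (endpoint (origin d) w2)).
    { rewrite <- (map_no_sign w2) at 1; apply sym_endpoint; auto using origin_length. }
    assert (Hlast : forall p, last_coord d (sym d no_sign (origin d) e p) = last_coord d p).
    { intros p; unfold last_coord; rewrite sym_nth, origin_nth by lia; unfold no_sign.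
      assert (E := next_x_last_coord d w1 Hd Hv1); fold e in E; unfold last_coord in E.
      rewrite E, Hh1; lia. }
    assert (Hxs : forall p, xc (sym d no_sign (origin d) e p) = (xc e + xc p)%Z).
    { intros p; unfold xc; rewrite sym_nth, origin_nth by lia; unfold no_sign; lia. }
    destruct (join_unfolded d n m 0%Z 0%Z w1 w2) as [Hin Hvis]; auto.
    + fold e; rewrite <- (map_no_sign w2).
      apply (sym_NoDup d no_sign (origin d) e); auto using origin_length.
    + fold e; rewrite HW; intros p Hp; apply in_map_iff in Hp as (q & <- & Hq).
      rewrite Hlast; auto.
    + fold e; rewrite HW, HE; intros p Hp; apply in_map_iff in Hp as (q & <- & Hq).
      specialize (Hx2 q Hq); rewrite !Hxs; lia.
    + fold e; rewrite HE, Hlast; auto.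
    + split; auto; unfold weight; rewrite Hvis; fold e; rewrite HW.
      unfold boundary_count; rewrite map_map, (map_ext _ (last_coord d)) by auto.
      fold (boundary_count d (walk_from (origin d) w2)); rewrite boundary_count_visits.
      rewrite pow_add; simpl; lra.
  - intros w1 w2 w1' w2' H1 H2 H1' H2' E.
    apply in_unfolded_walks_to in H1 as [[Hn1 _] _].
    apply in_unfolded_walks_to in H1' as [[Hn1' _] _].
    apply join_inj in E; auto; congruence.
Qed.

Lemma loops_le_Aplus d n a : 0 < a ->
  lsum (weight d a) (unfolded_walks_to d n 0) <= Aplus d n a.
Proof.
  intros Ha; rewrite Aplus_lsum; apply lsum_incl.
  - intros; apply Rlt_le, weight_pos; auto.
  - apply NoDup_unfolded_walks_to.
  - intros ss Hss; unfold unfolded_walks_to, unfolded_walks in Hss.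
    rewrite !filter_In in Hss; tauto.
Qed.

Lemma loops_0 d a : (2 <= d)%nat -> lsum (weight d a) (unfolded_walks_to d 0 0) = 1.
Proof.
  intros Hd.
  assert (H : In [] (unfolded_walks_to d 0 0)).
  { apply in_unfolded_walks_to; unfold end_height; simpl.
    assert (E : last_coord d (origin d) = 0%Z) by apply origin_nth.
    assert (E' : xc (origin d) = 0%Z) by apply origin_nth.
    repeat split; auto.
    - constructor.
    - repeat constructor; auto.
    - intros p [<-|[]]; lia.
    - destruct H as [<-|[]]; lia.
    - destruct H as [<-|[]]; lia. }
  assert (Hl : (length (unfolded_walks_to d 0 0) <= 1)%nat).
  { unfold unfolded_walks_to, unfolded_walks, positive_walks; simpl.
    repeat (match goal with |- context [if ?b then _ else _] => destruct b; simpl end); lia. }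
  assert (Hall : forall ss, In ss (unfolded_walks_to d 0 0) -> ss = []).
  { intros ss Hss; apply in_unfolded_walks_to in Hss as [[Hss _] _].
    now destruct ss. }
  destruct (unfolded_walks_to d 0 0) as [|w [|? ?]]; simpl in *; [contradiction| |lia].
  rewrite (Hall w) by auto; unfold weight, visits; simpl; lra.
Qed.

Lemma Aplus_0 d a : Aplus d 0 a = 1.
Proof.
  rewrite Aplus_lsum; unfold positive_walks; simpl.
  assert (E : positive_walk d [] = true).
  { apply positive_walk_spec; simpl; split; [repeat constructor; auto|].
    intros p [<-|[]]; unfold last_coord; rewrite origin_nth; lia. }
  rewrite E; simpl; unfold weight, visits; simpl; lra.
Qed.

(** * The growth rate *)

Lemma exp_le_compat x y : x <= y -> exp x <= exp y.
Proof. intros [H| ->]; [now apply Rlt_le, exp_increasing|lra]. Qed.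

Lemma nat_ge_R (x : R) : exists n0 : nat, forall n, (n0 <= n)%nat -> x <= INR n.
Proof.
  destruct (INR_unbounded x) as [n0 H]; exists n0; intros n Hn.
  apply le_INR in Hn; lra.
Qed.

(** [gamma] is the supremum of [f i / i], so the upper bound holds at every [i] without error term.
    For the lower bound a nearly optimal [i] is fixed and [n = q i + r]; the remainder costs a
    bounded amount. *)
Lemma Fekete (f : nat -> R) (B : R) :
  (forall i j, (1 <= i)%nat -> (1 <= j)%nat -> f i + f j <= f (i + j)%nat) ->
  (forall i, (1 <= i)%nat -> f i <= B * INR i) ->
  exists gamma, (forall i, (1 <= i)%nat -> f i <= gamma * INR i) /\
    forall eps, 0 < eps -> exists n0, forall n, (n0 <= n)%nat -> (gamma - eps) * INR n <= f n.
Proof.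
  intros Hsup Hub.
  assert (Hpos : forall i, (1 <= i)%nat -> 1 <= INR i) by (intros i Hi; now apply (le_INR 1)).
  destruct (completeness (fun x => exists i, (1 <= i)%nat /\ x = f i / INR i))
    as [gamma [Hg1 Hg2]].
  - exists B; intros x (i & Hi & ->); specialize (Hub i Hi); specialize (Hpos i Hi).
    apply Rle_div_l; lra.
  - exists (f 1%nat / INR 1), 1%nat; auto.
  - exists gamma; split.
    + intros i Hi; specialize (Hpos i Hi).
      assert (H : f i / INR i <= gamma) by (apply Hg1; exists i; auto).
      apply Rle_div_l in H; lra.
    + intros eps He.
      assert (Hex : exists i, (1 <= i)%nat /\ gamma - eps / 2 < f i / INR i).
      { apply Classical_Prop.NNPP; intros Hn.
        assert (gamma <= gamma - eps / 2); [|lra].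
        apply Hg2; intros x (i & Hi & ->).
        destruct (Rle_dec (f i / INR i) (gamma - eps / 2)); auto.
        exfalso; apply Hn; exists i; split; auto; lra. }
      destruct Hex as (i & Hi & Hs); set (s := f i / INR i) in *.
      assert (Hfi : f i = s * INR i).
      { unfold s; field; specialize (Hpos i Hi); lra. }
      assert (Hmul : forall k q, (1 <= k)%nat -> (1 <= q)%nat -> INR q * f k <= f (q * k)%nat).
      { intros k q Hk Hq; induction q as [|q IH]; [lia|].
        destruct q as [|q]; [simpl; rewrite Nat.add_0_r; lra|].
        specialize (IH ltac:(lia)).
        specialize (Hsup k (S q * k)%nat Hk ltac:(lia)).
        rewrite S_INR; replace (S (S q) * k)%nat with (k + S q * k)%nat by lia; lra. }
      (* Past this threshold the cost [INR i * (Rabs s + Rabs (f 1))] of the remainder is at most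
         [eps / 2 * INR n]. *)
      destruct (nat_ge_R (2 * (INR i * (Rabs s + Rabs (f 1%nat))) / eps)) as [n0 Hn0].
      exists (n0 + i)%nat; intros n Hn; specialize (Hn0 n ltac:(lia)).
      set (q := (n / i)%nat); set (r := (n mod i)%nat).
      assert (En : n = (q * i + r)%nat).
      { unfold q, r; rewrite (Nat.div_mod n i) at 1; lia. }
      assert (Hr : (r < i)%nat) by (apply Nat.mod_upper_bound; lia).
      assert (Hq : (1 <= q)%nat) by nia.
      pose proof (Hmul i q Hi Hq) as H1; rewrite Hfi in H1.
      assert (H2 : f n >= f (q * i)%nat - INR i * Rabs (f 1%nat)).
      { pose proof (Rabs_pos (f 1%nat)); pose proof (Hpos i Hi).
        (* Superadditivity is assumed only from index 1 on, so a zero remainder is treated apart. *)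
        destruct r as [|r'].
        - rewrite En, Nat.add_0_r; nra.
        - specialize (Hsup (q * i)%nat (S r') ltac:(nia) ltac:(lia)); rewrite <- En in Hsup.
          pose proof (Hmul 1%nat (S r') ltac:(lia) ltac:(lia)) as H3.
          rewrite Nat.mul_1_r in H3.
          assert (- (INR i * Rabs (f 1%nat)) <= INR (S r') * f 1%nat); [|lra].
          assert (INR (S r') <= INR i) by (apply le_INR; lia).
          pose proof (pos_INR (S r')).
          pose proof (Rle_abs (- f 1%nat)) as H5; rewrite Rabs_Ropp in H5.
          assert (INR (S r') * - f 1%nat <= INR i * Rabs (f 1%nat)); [|lra].
          apply Rle_trans with (INR (S r') * Rabs (f 1%nat)); nra. }
      assert (HnR : INR n = INR q * INR i + INR r) by (rewrite En at 1; rewrite plus_INR, mult_INR; auto).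
      apply Rle_div_l in Hn0; [|lra].
      assert (INR r <= INR i) by (apply le_INR; lia).
      pose proof (pos_INR r); pose proof (pos_INR n).
      assert (INR r * s <= INR i * Rabs s).
      { pose proof (Rle_abs s); pose proof (Rabs_pos s).
        apply Rle_trans with (INR r * Rabs s); nra. }
      assert (INR q * (s * INR i) = (INR n - INR r) * s) by (rewrite HnR; ring).
      nra.
Qed.

(** From [ln y = 2 ln (sqrt y)] and [ln x / x -> 0] at [x = sqrt y]; the product [8 * 2] is the
    origin of [eps / 16]. *)
Lemma sqrt_mult_ln_small eps : 0 < eps ->
  exists n0, forall n, (n0 <= n)%nat -> 8 * sqrt (INR n) * ln (INR n) <= eps * INR n.
Proof.
  intros He.
  pose proof is_lim_div_ln_p as H; apply is_lim_spec in H; simpl in H.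
  destruct (H (mkposreal (eps / 16) ltac:(lra))) as [M HM]; simpl in HM.
  destruct (nat_ge_R (Rsqr (Rmax M 1 + 1))) as [n0 Hn0].
  exists (n0 + 1)%nat; intros n Hn; specialize (Hn0 n ltac:(lia)).
  set (y := INR n) in *.
  assert (Hm : 1 <= Rmax M 1) by apply Rmax_r.
  assert (HM' : M <= Rmax M 1) by apply Rmax_l.
  assert (Hs : Rmax M 1 + 1 <= sqrt y).
  { rewrite <- (sqrt_Rsqr (Rmax M 1 + 1)) by lra; now apply sqrt_le_1_alt. }
  specialize (HM (sqrt y) ltac:(lra)).
  rewrite Rminus_0_r in HM.
  assert (Hy : 0 < y) by (unfold Rsqr in Hn0; nra).
  assert (Hln : ln y = 2 * ln (sqrt y)).
  { rewrite <- (sqrt_sqrt y) at 1 by lra; rewrite ln_mult by lra; lra. }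
  pose proof (Rle_abs (ln (sqrt y) / sqrt y)) as Ha.
  assert (Hl : ln (sqrt y) / sqrt y <= eps / 16) by lra.
  apply (proj1 (Rle_div_l (ln (sqrt y)) (eps / 16) (sqrt y) ltac:(lra))) in Hl.
  assert (Hyy : sqrt y * sqrt y = y) by (apply sqrt_sqrt; lra).
  rewrite Hln; replace (eps * y) with (eps * (sqrt y * sqrt y)) by (rewrite Hyy; auto).
  assert (sqrt y * ln (sqrt y) <= sqrt y * (eps / 16 * sqrt y)) by (apply Rmult_le_compat_l; lra).
  lra.
Qed.

Lemma ln_code_count_small eps : 0 < eps -> exists n0, forall n, (n0 <= n)%nat ->
  ln (INR (code_count n) * INR (S n)) <= eps * INR n.
Proof.
  intros He.
  destruct (sqrt_mult_ln_small (eps / 2)) as [n0 Hn0]; [lra|].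
  exists (n0 + 2)%nat; intros n Hn.
  specialize (Hn0 (n + 2)%nat ltac:(lia)).
  set (y := INR (n + 2)) in *.
  assert (Hy : y = INR n + 2) by (unfold y; rewrite plus_INR; simpl; lra).
  assert (Hn2 : 2 <= INR n) by (apply (le_INR 2); lia).
  assert (Hl : 0 < ln y) by (rewrite <- ln_1; apply ln_increasing; lra).
  assert (H1 : INR (code_count n) * INR (S n) <= y ^ (2 * fold_bound n + 2)).
  { unfold code_count; rewrite pow_INR; fold y.
    replace (2 * fold_bound n + 2)%nat with (S (2 * fold_bound n + 1)) by lia.
    rewrite <- tech_pow_Rmult, Rmult_comm; apply Rmult_le_compat_r.
    - apply pow_le; lra.
    - rewrite S_INR; lra. }
  assert (Hc : 0 < INR (code_count n) * INR (S n)).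
  { apply Rmult_lt_0_compat; [|apply lt_0_INR; lia].
    unfold code_count; rewrite pow_INR; fold y; apply pow_lt; lra. }
  apply Rle_trans with (ln (y ^ (2 * fold_bound n + 2))); [now apply ln_le|].
  rewrite ln_pow by lra.
  (* The exponent is [2 s + 4], where [s <= 2 sqrt y] and [1 <= sqrt y]. *)
  assert (Hk : INR (2 * fold_bound n + 2) <= 8 * sqrt y).
  { rewrite plus_INR, mult_INR; unfold fold_bound; rewrite (S_INR (Nat.sqrt _)); simpl (INR 2).
    set (s := Nat.sqrt (2 * n)).
    assert (Hs : INR s <= 2 * sqrt y).
    { assert (Hss : (s * s <= 2 * n)%nat) by (apply Nat.sqrt_spec; lia).
      apply le_INR in Hss; rewrite !mult_INR in Hss; simpl (INR 2) in Hss.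
      replace (2 * sqrt y) with (sqrt (4 * y)).
      - rewrite <- (sqrt_Rsqr (INR s)) by apply pos_INR; apply sqrt_le_1_alt.
        unfold Rsqr; lra.
      - replace 4 with (2 * 2) by lra; rewrite sqrt_mult, sqrt_square by lra; lra. }
    assert (1 <= sqrt y) by (rewrite <- sqrt_1; apply sqrt_le_1_alt; lra).
    lra. }
  apply Rle_trans with (8 * sqrt y * ln y); [apply Rmult_le_compat_r; lra|].
  eapply Rle_trans; [apply Hn0|]; rewrite Hy; nra.
Qed.

Lemma Aplus_growth d a : (2 <= d)%nat -> 0 < a ->
  exists gamma, forall eps, 0 < eps -> exists n0, forall n, (n0 <= n)%nat ->
    exp ((gamma - eps) * INR n) <= Aplus d n a <= exp ((gamma + eps) * INR n).
Proof.
  intros Hd Ha.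
  set (L := fun n => lsum (weight d a) (unfolded_walks_to d n 0)).
  (* Gluing gives [(a L n) (a L m) <= a L (n + m + 1)]; the index shift absorbs the inserted step
     and makes [ln g] superadditive. *)
  set (g := fun i => a * L (Nat.pred i)).
  (* Gluing on the empty walk lengthens a loop by one step, so loops of every length exist. *)
  assert (HL : forall n, 0 < a * L n).
  { induction n as [|n IH].
    - unfold L; rewrite loops_0 by auto; lra.
    - pose proof (loops_supermultiplicative d n 0 a Hd Ha) as H; fold (L n) in H.
      rewrite loops_0 in H by auto; replace (n + 0 + 1)%nat with (S n) in H by lia.
      fold (L (S n)) in H; nra. }
  assert (Hsup : forall i j, (1 <= i)%nat -> (1 <= j)%nat ->
    ln (g i) + ln (g j) <= ln (g (i + j)%nat)).
  { intros i j Hi Hj; unfold g; rewrite <- ln_mult by apply HL.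
    apply ln_le; [apply Rmult_lt_0_compat; apply HL|].
    pose proof (loops_supermultiplicative d (Nat.pred i) (Nat.pred j) a Hd Ha) as H.
    replace (Nat.pred i + Nat.pred j + 1)%nat with (Nat.pred (i + j)) in H by lia.
    fold (L (Nat.pred i)) (L (Nat.pred j)) (L (Nat.pred (i + j))) in H.
    apply Rle_trans with (a * (a * L (Nat.pred i) * L (Nat.pred j))); [lra|].
    apply Rmult_le_compat_l; lra. }
  set (b := INR (2 * d) * Rmax 1 a).
  assert (Hb : 1 <= b).
  { unfold b; assert (1 <= INR (2 * d)) by (apply (le_INR 1); lia).
    pose proof (Rmax_l 1 a); nra. }
  destruct (Fekete (fun i => ln (g i)) (Rabs (ln a) + ln b) Hsup) as (gamma & Hg1 & Hg2).
  { intros [|n] Hi; [lia|]; unfold g; simpl Nat.pred.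
    assert (HLn : 0 < L n) by (specialize (HL n); nra).
    rewrite ln_mult by auto.
    assert (ln (L n) <= INR n * ln b).
    { rewrite <- ln_pow by lra; apply ln_le; auto.
      eapply Rle_trans; [apply loops_le_Aplus; auto|apply Aplus_upper; auto]. }
    assert (0 <= ln b) by (rewrite <- ln_1; apply ln_le; lra).
    rewrite S_INR; pose proof (Rle_abs (ln a)); pose proof (Rabs_pos (ln a)).
    pose proof (pos_INR n); nra. }
  exists gamma; intros eps He.
  destruct (Hg2 (eps / 2)) as [n1 Hn1]; [lra|].
  destruct (ln_code_count_small (eps / 2)) as [n2 Hn2]; [lra|].
  (* Absorbs the constants coming from the index shift and from [ln a]. *)
  destruct (nat_ge_R ((Rabs gamma + eps + Rabs (ln a)) * 2 / eps)) as [n3 Hn3].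
  exists (n1 + n2 + n3)%nat; intros n Hn.
  specialize (Hn2 n ltac:(lia)); specialize (Hn3 n ltac:(lia)).
  apply Rle_div_l in Hn3; [|lra].
  pose proof (Rle_abs (ln a)); pose proof (Rle_abs (- ln a)) as Hla; rewrite Rabs_Ropp in Hla.
  pose proof (Rle_abs gamma); pose proof (Rle_abs (- gamma)) as Hga; rewrite Rabs_Ropp in Hga.
  pose proof (pos_INR n).
  split.
  - apply Rle_trans with (L n); [|now apply loops_le_Aplus].
    specialize (Hn1 (S n) ltac:(lia)); unfold g in Hn1; simpl Nat.pred in Hn1.
    assert (HLn : 0 < L n) by (specialize (HL n); nra).
    rewrite <- (exp_ln (L n)) by auto.
    rewrite ln_mult in Hn1 by auto; rewrite S_INR in Hn1.
    apply exp_le_compat; nra.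
  - pose proof (Aplus_le_unfolded d n a Hd Ha) as HA1.
    destruct (unfolded_pigeonhole d n a Hd Ha) as [h HA2].
    pose proof (unfolded_to_loops d n h a Hd Ha) as HA3.
    set (X := lsum (weight d a) (unfolded_walks_to d n h)) in *.
    fold (L (n + n + 1)%nat) in HA3.
    specialize (Hg1 (S (n + n + 1)) ltac:(lia)); unfold g in Hg1; simpl Nat.pred in Hg1.
    assert (HX0 : 0 <= X) by (apply lsum_nonneg; intros; apply Rlt_le, weight_pos; auto).
    (* The square of [a X] is at most [a L (2 n + 1) = g (2 n + 2)], so the square root returns
       exactly the rate [gamma]. *)
    assert (HX : a * X <= exp (gamma * (INR n + 1))).
    { apply Rsqr_incr_0_var; [|apply Rlt_le, exp_pos].
      unfold Rsqr; rewrite <- exp_plus.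
      apply Rle_trans with (a * L (n + n + 1)%nat).
      - apply Rle_trans with (a * (a * X * X)); [lra|apply Rmult_le_compat_l; lra].
      - rewrite <- (exp_ln (a * L (n + n + 1)%nat)) by auto; apply exp_le_compat.
        rewrite S_INR, !plus_INR in Hg1; simpl (INR 1) in Hg1; lra. }
    set (cc := INR (code_count n)) in *.
    assert (Hcc : 0 < cc).
    { unfold cc, code_count; apply lt_0_INR; assert (Hnz := Nat.pow_nonzero (n + 2) (2 * fold_bound n + 1)); lia. }
    assert (HSn : 0 < INR (S n)) by (apply lt_0_INR; lia).
    assert (HA : Aplus d n a <= cc * INR (S n) * X) .
    { eapply Rle_trans; [apply HA1|]; rewrite Rmult_assoc; apply Rmult_le_compat_l; lra. }
    eapply Rle_trans; [apply HA|].
    assert (HX' : X <= exp (gamma * (INR n + 1) - ln a)).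
    { unfold Rminus; rewrite exp_plus, exp_Ropp, exp_ln by auto.
      apply Rle_div_r; lra. }
    rewrite <- (exp_ln (cc * INR (S n))) by (apply Rmult_lt_0_compat; auto).
    eapply Rle_trans; [apply Rmult_le_compat_l; [apply Rlt_le, exp_pos|apply HX']|].
    rewrite <- exp_plus; apply exp_le_compat; nra.
Qed.

(** * Averages over equally spaced nodes *)

(** The free phase makes one identity serve cosine sums ([c = 0]) and sine sums ([c = - PI / 2]), in
    place of complex exponentials. *)
Lemma cos_sum_telescope x c n :
  2 * sin (x / 2) * lsum (fun j => cos (INR j * x + c)) (seq 0 n)
  = sin (INR n * x - x / 2 + c) - sin (c - x / 2).
Proof.
  induction n as [|n IH].
  - simpl; replace (0 * x - x / 2 + c) with (c - x / 2) by lra; lra.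
  - rewrite lsum_seq_S, Rmult_plus_distr_l, IH, S_INR.
    replace ((INR n + 1) * x - x / 2 + c) with ((INR n * x + c) + x / 2) by lra.
    replace (INR n * x - x / 2 + c) with ((INR n * x + c) - x / 2) by lra.
    rewrite sin_plus, sin_minus; lra.
Qed.

Definition node (M : nat) (c : R) (j : nat) : R := c + 2 * PI * INR j / INR M.

(** The powers of a nontrivial [M]-th root of unity sum to 0; [0 < m < M] keeps the factor
    [sin (PI m / M)] of the telescoped sum positive. *)
Lemma node_cos_sum M c0 m c : (0 < m < M)%nat ->
  lsum (fun j => cos (INR m * node M c0 j + c)) (seq 0 M) = 0.
Proof.
  intros [Hm HM].
  assert (Hm' : 0 < INR m) by (now apply lt_0_INR).
  assert (HM' : INR m < INR M) by (now apply lt_INR).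
  pose proof PI_RGT_0.
  set (x := 2 * PI * INR m / INR M).
  assert (Hx : 0 < sin (x / 2)).
  { assert (E : x / 2 = PI * (INR m / INR M)) by (unfold x; field; lra).
    assert (0 < INR m / INR M < 1).
    { split; [apply Rdiv_lt_0_compat; lra|apply Rlt_div_l; lra]. }
    rewrite E; apply sin_gt_0; nra. }
  pose proof (cos_sum_telescope x (INR m * c0 + c) M) as H1.
  replace (INR M * x - x / 2 + (INR m * c0 + c)) with
    ((INR m * c0 + c - x / 2) + 2 * INR m * PI) in H1 by (unfold x; field; lra).
  rewrite sin_period, Rminus_diag in H1.
  apply Rmult_integral in H1 as [H1|H1]; [lra|].
  rewrite <- H1; apply lsum_ext; intros j _; f_equal; unfold node, x; field; lra.
Qed.

(** Discrete orthogonality: the product splits into the frequencies [m + l] and [m - l], and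
    [m + l < M] excludes aliasing, so only a zero difference survives. *)
Lemma node_cos_product M c0 m l c t : (1 <= l)%nat -> (m + l < M)%nat ->
  lsum (fun j => cos (INR m * node M c0 j + c) * cos (INR l * (node M c0 j - t))) (seq 0 M)
  = if Nat.eqb m l then INR M / 2 * cos (INR m * t + c) else 0.
Proof.
  intros Hl HM.
  rewrite (lsum_ext _ (fun j =>
    / 2 * cos (INR (m + l) * node M c0 j + (c - INR l * t)) +
    / 2 * cos ((INR m - INR l) * node M c0 j + (c + INR l * t)))).
  - rewrite lsum_plus, !lsum_scal, node_cos_sum by lia.
    destruct (Nat.eqb_spec m l) as [->|Hne].
    + rewrite (lsum_ext _ (fun _ => cos (INR l * t + c))), lsum_const, length_seq; [field|].
      intros; f_equal; ring.
    + destruct (le_lt_dec l m) as [Hle|Hlt].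
      * rewrite <- minus_INR by lia; rewrite node_cos_sum by lia; lra.
      * rewrite (lsum_ext _ (fun j => cos (INR (l - m) * node M c0 j + - (c + INR l * t)))).
        -- rewrite node_cos_sum by lia; lra.
        -- intros j _; rewrite <- cos_neg, minus_INR by lia; f_equal; ring.
  - intros j _; rewrite plus_INR.
    replace ((INR m + INR l) * node M c0 j + (c - INR l * t)) with
      ((INR m * node M c0 j + c) + INR l * (node M c0 j - t)) by ring.
    replace ((INR m - INR l) * node M c0 j + (c + INR l * t)) with
      ((INR m * node M c0 j + c) - INR l * (node M c0 j - t)) by ring.
    generalize (INR m * node M c0 j + c) as u; intros u.
    rewrite cos_plus, cos_minus; lra.
Qed.

(** * The logarithmic kernel on the circle of radius 1/2 *)

(** The real part of [e^(it) (1 - z^L) / (1 - z)] for [z = r e^(it)], cleared of the denominator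
    [|1 - z|^2]. *)
Lemma geometric_cos_sum r t L :
  (1 - 2 * r * cos t + r ^ 2) * lsum (fun l => r ^ l * cos (INR (S l) * t)) (seq 0 L)
  = cos t - r - r ^ L * cos (INR (S L) * t) + r ^ S L * cos (INR L * t).
Proof.
  induction L as [|L IH].
  - simpl; replace (0 * t) with 0 by ring; replace (1 * t) with t by ring.
    rewrite cos_0; ring.
  - rewrite lsum_seq_S, Rmult_plus_distr_l, IH.
    replace (INR (S (S L)) * t) with (INR (S L) * t + t) by (rewrite (S_INR (S L)); ring).
    replace (INR L * t) with (INR (S L) * t - t) by (rewrite (S_INR L); ring).
    rewrite cos_plus, cos_minus; simpl; ring.
Qed.

Lemma is_derive_log_sum t L r :
  is_derive (fun r => lsum (fun l => r ^ S l * cos (INR (S l) * t) / INR (S l)) (seq 0 L)) r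
    (lsum (fun l => r ^ l * cos (INR (S l) * t)) (seq 0 L)).
Proof.
  induction L as [|L IH].
  - simpl; apply (is_derive_const 0).
  - eapply is_derive_ext; [intros s; symmetry; apply lsum_seq_S|].
    rewrite lsum_seq_S; apply (is_derive_plus (V := R_NormedModule)); [exact IH|].
    auto_derive; auto.
    change (match L with O => 1 | S _ => INR L + 1 end) with (INR (S L)).
    simpl Nat.pred; field; apply not_0_INR; lia.
Qed.

(** [/ 2 * ln (5 / 4 - cos t)] is [log |1 - e^(it) / 2|], and the sum is minus its truncated Taylor
    series. In the radius [r] the derivative of the difference is the remainder of a geometric sum
    over [D r = |1 - r e^(it)|^2 >= / 4], at most [8 (/ 2)^L]; the mean value theorem on [[0, / 2]]
    gives the constant 4 and avoids infinite series. *)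
Lemma log_kernel_expansion t L :
  Rabs (/ 2 * ln (5 / 4 - cos t) +
        lsum (fun l => (/ 2) ^ S l * cos (INR (S l) * t) / INR (S l)) (seq 0 L))
  <= 4 * (/ 2) ^ L.
Proof.
  set (S_ := fun r => lsum (fun l => r ^ S l * cos (INR (S l) * t) / INR (S l)) (seq 0 L)).
  set (D := fun r => 1 - 2 * r * cos t + r ^ 2).
  set (h := fun r => / 2 * ln (D r) + S_ r).
  pose proof (COS_bound t) as Hc.
  assert (HD : forall r, 0 <= r <= / 2 -> / 4 <= D r).
  { intros r Hr; unfold D; assert ((1 - r) ^ 2 <= 1 - 2 * r * cos t + r ^ 2) by nra.
    assert (/ 4 <= (1 - r) ^ 2) by nra; lra. }
  set (dh := fun r => (- r ^ L * cos (INR (S L) * t) + r ^ S L * cos (INR L * t)) / D r).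
  assert (Hder : forall r, 0 <= r <= / 2 -> is_derive h r (dh r)).
  { intros r Hr; specialize (HD r Hr).
    replace (dh r) with ((r - cos t) / D r +
       lsum (fun l => r ^ l * cos (INR (S l) * t)) (seq 0 L)).
    - apply (is_derive_plus (V := R_NormedModule)); [|apply is_derive_log_sum].
      unfold D; auto_derive; [unfold D in HD; lra|].
      field; unfold D in HD; lra.
    - pose proof (geometric_cos_sum r t L) as H; fold (D r) in H.
      unfold dh; apply Rmult_eq_reg_l with (D r); [|lra].
      rewrite Rmult_plus_distr_l, H; field; lra. }
  assert (Hbound : forall r, 0 <= r <= / 2 -> Rabs (dh r) <= 8 * (/ 2) ^ L).
  { intros r Hr; specialize (HD r Hr); unfold dh.
    assert (Hp : 0 <= r ^ L <= (/ 2) ^ L) by (split; [apply pow_le; lra|apply pow_incr; lra]).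
    unfold Rdiv; rewrite Rabs_mult, (Rabs_right (/ D r)).
    - assert (Hi : / D r <= 4).
      { rewrite <- (Rinv_inv 4); apply Rinv_le_contravar; lra. }
      assert (0 < / D r) by (apply Rinv_0_lt_compat; lra).
      assert (Hn : Rabs (- r ^ L * cos (INR (S L) * t) + r ^ S L * cos (INR L * t)) <= 2 * (/ 2) ^ L).
      { pose proof (COS_bound (INR (S L) * t)); pose proof (COS_bound (INR L * t)).
        simpl pow; apply Rabs_le; generalize dependent (r ^ L); generalize ((/ 2) ^ L).
        intros P p Hp.
        assert (Hrp : 0 <= r * p <= p) by nra.
        assert (- p <= p * cos (INR (S L) * t) <= p) by nra.
        assert (- (r * p) <= r * p * cos (INR L * t) <= r * p) by nra.
        lra. }
      replace (8 * (/ 2) ^ L) with ((2 * (/ 2) ^ L) * 4) by ring.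
      apply Rmult_le_compat; auto; [apply Rabs_pos|lra].
    - apply Rle_ge, Rlt_le, Rinv_0_lt_compat; lra. }
  destruct (MVT_gen h 0 (/ 2) dh) as (c & Hc' & E).
  - intros x; rewrite Rmin_left, Rmax_right by lra; intros Hx; apply Hder; lra.
  - intros x; rewrite Rmin_left, Rmax_right by lra; intros Hx.
    apply continuity_pt_filterlim; apply (ex_derive_continuous h); exists (dh x); apply Hder; lra.
  - rewrite Rmin_left, Rmax_right in Hc' by lra.
    assert (h0 : h 0 = 0).
    { unfold h, D, S_; rewrite (lsum_ext _ (fun _ => 0)), lsum_const.
      - replace (1 - 2 * 0 * cos t + 0 ^ 2) with 1 by ring; rewrite ln_1; ring.
      - intros l _; simpl; unfold Rdiv; ring. }
    assert (Eh : h (/ 2) = / 2 * ln (5 / 4 - cos t) + S_ (/ 2)).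
    { unfold h, D; f_equal; f_equal; f_equal; field. }
    fold (S_ (/ 2)); rewrite <- Eh.
    replace (h (/ 2)) with (dh c * / 2) by lra.
    rewrite Rabs_mult, (Rabs_right (/ 2)) by lra.
    specialize (Hbound c Hc'); lra.
Qed.

(* Integrate the upper bound for the potential against the nonnegative density [1 - cos (m phi + c)]. *)
Lemma power_sum_bound (ths : list R) (b : R) (m L : nat) (c : R) :
  (1 <= m <= L)%nat ->
  (forall phi, lsum (fun th => / 2 * ln (5 / 4 - cos (phi - th))) ths <= b) ->
  lsum (fun th => cos (INR m * th + c)) ths
   <= 2 * INR m * 2 ^ m * (b + 4 * (/ 2) ^ L * INR (length ths)).
Proof.
  intros [Hm HL] Hb.
  (* Frequencies up to [m + L <= 2 L < M] occur, so averages over [M] nodes are exact; [e] is the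
     truncation error per point. *)
  set (M := (2 * L + 1)%nat); set (e := 4 * (/ 2) ^ L).
  assert (HM : 0 < INR M) by (apply lt_0_INR; lia).
  assert (HmR : 0 < INR m) by (apply lt_0_INR; lia).
  set (x := node M 0).
  set (w := fun j => 1 + - cos (INR m * x j + c)).
  assert (Hw : forall j, 0 <= w j) by (intros j; unfold w; pose proof (COS_bound (INR m * x j + c)); lra).
  assert (Hsw : lsum w (seq 0 M) = INR M).
  { unfold w; rewrite lsum_plus, lsum_const, length_seq.
    rewrite (lsum_ext (fun j => - _) (fun j => -1 * cos (INR m * x j + c))) by (intros; lra).
    rewrite lsum_scal; unfold x; rewrite node_cos_sum by lia; lra. }
  set (T := fun t => lsum (fun l => (/ 2) ^ S l * cos (INR (S l) * t) / INR (S l)) (seq 0 L)).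
  (* The expansion has no constant term, so the 1 in the density contributes nothing and only the
     frequency [m] survives. *)
  assert (HT : forall th, lsum (fun j => w j * T (x j - th)) (seq 0 M)
     = - ((/ 2) ^ m / INR m * (INR M / 2)) * cos (INR m * th + c)).
  { intros th; unfold T.
    rewrite (lsum_ext _ (fun j => lsum (fun l => (/ 2) ^ S l / INR (S l) *
      (w j * cos (INR (S l) * (x j - th)))) (seq 0 L))).
    2:{ intros j _; rewrite <- lsum_scal; apply lsum_ext; intros; unfold Rdiv; ring. }
    rewrite lsum_swap.
    rewrite (lsum_ext _ (fun l => if Nat.eqb (Nat.pred m) l then
      - ((/ 2) ^ m / INR m * (INR M / 2)) * cos (INR m * th + c) else 0)).
    - rewrite (lsum_indicator (fun _ => _)); auto; lia.
    - intros l Hl; apply in_seq in Hl; rewrite lsum_scal; unfold w.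
      rewrite (lsum_ext _ (fun j => cos (INR (S l) * x j + - (INR (S l) * th)) +
         -1 * (cos (INR m * x j + c) * cos (INR (S l) * (x j - th))))).
      + rewrite lsum_plus, lsum_scal; unfold x; rewrite node_cos_sum, node_cos_product by lia.
        destruct (Nat.eqb_spec m (S l)), (Nat.eqb_spec (Nat.pred m) l); try lia.
        * subst m; unfold Rdiv; ring.
        * ring.
      + intros j _; replace (INR (S l) * (x j - th)) with (INR (S l) * x j + - (INR (S l) * th)) by ring.
        ring. }
  assert (H : lsum (fun j => w j * lsum (fun th => - T (x j - th) - e) ths) (seq 0 M)
     <= lsum (fun j => w j * b) (seq 0 M)).
  { apply lsum_le; intros j _; apply Rmult_le_compat_l; auto.
    eapply Rle_trans; [|apply (Hb (x j))]; apply lsum_le; intros th _.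
    pose proof (log_kernel_expansion (x j - th) L) as HK; fold (T (x j - th)) e in HK.
    apply Rabs_le_between in HK; lra. }
  rewrite (lsum_ext (fun j => w j * b) (fun j => b * w j)) in H by (intros; ring).
  rewrite lsum_scal, Hsw in H.
  rewrite (lsum_ext (fun j => w j * lsum _ ths)
    (fun j => lsum (fun th => -1 * (w j * T (x j - th)) + - e * w j) ths)) in H.
  2:{ intros j _; rewrite <- lsum_scal; apply lsum_ext; intros; ring. }
  rewrite lsum_swap in H.
  rewrite (lsum_ext _ (fun th => (/ 2) ^ m / INR m * (INR M / 2) * cos (INR m * th + c) + - e * INR M)) in H.
  2:{ intros th _; rewrite lsum_plus, !lsum_scal, HT, Hsw; ring. }
  rewrite lsum_plus, lsum_scal, lsum_const in H.
  set (Sg := lsum (fun th => cos (INR m * th + c)) ths) in *.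
  set (NN := INR (length ths)) in *.
  assert (H2m : 0 < 2 ^ m) by (apply pow_lt; lra).
  assert (H' : (/ 2) ^ m / INR m / 2 * Sg <= b + e * NN).
  { apply Rmult_le_reg_r with (INR M); [lra|]; lra. }
  rewrite pow_inv in H'.
  apply Rmult_le_reg_l with (/ 2 ^ m / INR m / 2).
  - repeat apply Rdiv_lt_0_compat; try lra; now apply Rinv_0_lt_compat.
  - eapply Rle_trans; [apply H'|]; right; field; lra.
Qed.

(** * From power sums to arcs *)

(* [n] times the Fejer kernel. *)
Definition fejer (n : nat) (x : R) : R :=
  lsum (fun l => lsum (fun l' => cos ((INR l - INR l') * x)) (seq 0 n)) (seq 0 n).

(** The kernel is [|sum e^(ilx)|^2]; the squares are those of the real and imaginary parts.
    Nonnegativity and decay are read off this form. *)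
Lemma fejer_squares n x : fejer n x =
  Rsqr (lsum (fun l => cos (INR l * x + 0)) (seq 0 n)) +
  Rsqr (lsum (fun l => cos (INR l * x + - (PI / 2))) (seq 0 n)).
Proof.
  unfold fejer, Rsqr; rewrite <- !lsum_scal, <- lsum_plus; apply lsum_ext; intros l _.
  rewrite (Rmult_comm (lsum _ _) (cos (INR l * x + 0))).
  rewrite (Rmult_comm (lsum _ _) (cos (INR l * x + - (PI / 2)))).
  rewrite <- !lsum_scal, <- lsum_plus; apply lsum_ext; intros l' _.
  assert (E : forall u, cos (u + - (PI / 2)) = sin u).
  { intros u; rewrite <- cos_shift, <- cos_neg; f_equal; ring. }
  rewrite !E, !Rplus_0_r, Rmult_minus_distr_r, cos_minus; ring.
Qed.

Lemma fejer_nonneg n x : 0 <= fejer n x.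
Proof. rewrite fejer_squares; apply Rplus_le_le_0_compat; apply Rle_0_sqr. Qed.

Lemma fejer_decay n x : Rsqr (sin (x / 2)) * fejer n x <= 2.
Proof.
  assert (H : forall c, Rsqr (sin (x / 2)) * Rsqr (lsum (fun l => cos (INR l * x + c)) (seq 0 n)) <= 1).
  { intros c; rewrite <- Rsqr_mult.
    pose proof (cos_sum_telescope x c n) as E.
    pose proof (SIN_bound (INR n * x - x / 2 + c)); pose proof (SIN_bound (c - x / 2)).
    rewrite <- Rsqr_1; apply Rsqr_le_abs_1; rewrite (Rabs_right 1) by lra.
    apply Rabs_le; lra. }
  rewrite fejer_squares; pose proof (H 0); pose proof (H (- (PI / 2))); lra.
Qed.

Lemma cos_diff_INR n l l' : (l < n)%nat -> (l' < n)%nat -> l <> l' ->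
  exists m, (1 <= m < n)%nat /\ forall x, cos ((INR l - INR l') * x) = cos (INR m * x).
Proof.
  intros Hl Hl' Hne; destruct (le_lt_dec l' l) as [H|H].
  - exists (l - l')%nat; split; [lia|]; intros x; now rewrite minus_INR.
  - exists (l' - l)%nat; split; [lia|]; intros x.
    rewrite minus_INR, <- cos_neg by lia; f_equal; ring.
Qed.

(** Frequencies [l - l'] with [l <> l'] are below [n] in absolute value and cancel over [n] nodes,
    leaving the diagonal. Up to the factor [n^2] the translates to the nodes form a partition of
    unity. *)
Lemma fejer_node_sum n c0 t : lsum (fun j => fejer n (t - node n c0 j)) (seq 0 n) = INR n * INR n.
Proof.
  unfold fejer; rewrite lsum_swap.
  rewrite (lsum_ext _ (fun _ => INR n)), lsum_const, length_seq; [ring|].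
  intros l Hl; apply in_seq in Hl; rewrite lsum_swap.
  rewrite (lsum_ext _ (fun l' => if Nat.eqb l l' then INR n else 0)).
  - rewrite (lsum_indicator (fun _ => INR n)); [auto|lia].
  - intros l' Hl'; apply in_seq in Hl'.
    destruct (Nat.eqb_spec l l') as [<-|Hne].
    + rewrite (lsum_ext _ (fun _ => 1)), lsum_const, length_seq; [ring|].
      intros; replace ((INR l - INR l) * _) with 0 by ring; apply cos_0.
    + destruct (cos_diff_INR n l l') as (m & Hm & E); [lia|lia|auto|].
      rewrite <- (node_cos_sum n c0 m (- (INR m * t))) by lia.
      apply lsum_ext; intros j _; rewrite E, <- cos_neg; f_equal; ring.
Qed.

(** Diagonal pairs contribute the number of points, off-diagonal ones a power sum. Bounding by
    [Rmax 0 eta] allows the error to be added to all [n^2] pairs alike. *)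
Lemma fejer_weyl_sum n (ths : list R) (eta y : R) :
  (forall m c, (1 <= m < n)%nat -> lsum (fun th => cos (INR m * th + c)) ths <= eta) ->
  lsum (fun th => fejer n (th - y)) ths <= INR n * INR (length ths) + INR n * INR n * Rmax 0 eta.
Proof.
  intros H; unfold fejer.
  rewrite lsum_swap.
  apply Rle_trans with (lsum (fun l : nat => INR (length ths) + INR n * Rmax 0 eta) (seq 0 n)).
  - apply lsum_le; intros l Hl; apply in_seq in Hl; rewrite lsum_swap.
    apply Rle_trans with (lsum (fun l' => (if Nat.eqb l l' then INR (length ths) else 0) + Rmax 0 eta) (seq 0 n)).
    + apply lsum_le; intros l' Hl'; apply in_seq in Hl'.
      destruct (Nat.eqb_spec l l') as [<-|Hne].
      * rewrite (lsum_ext _ (fun _ => 1)), lsum_const.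
        -- pose proof (Rmax_l 0 eta); lra.
        -- intros; replace ((INR l - INR l) * _) with 0 by ring; apply cos_0.
      * destruct (cos_diff_INR n l l') as (m & Hm & E); [lia|lia|auto|].
        rewrite (lsum_ext _ (fun th => cos (INR m * th + - (INR m * y)))).
        -- specialize (H m (- (INR m * y)) Hm); pose proof (Rmax_r 0 eta); lra.
        -- intros th _; rewrite E; f_equal; ring.
    + rewrite lsum_plus, lsum_const, length_seq, (lsum_indicator (fun _ => INR (length ths))) by lia.
      lra.
  - rewrite lsum_const, length_seq; lra.
Qed.

Lemma count_below M x : 0 <= x ->
  lsum (fun j => if Rle_dec (INR j) x then 1 else 0) (seq 0 M) <= x + 1.
Proof.
  intros Hx; induction M as [|M IH]; [simpl; lra|].
  rewrite lsum_seq_S; destruct (Rle_dec (INR M) x) as [H|H]; [|lra].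
  assert (lsum (fun j => if Rle_dec (INR j) x then 1 else 0) (seq 0 M) <= INR M * 1).
  { rewrite <- (length_seq M 0) at 2; rewrite <- lsum_const; apply lsum_le.
    intros j _; destruct (Rle_dec (INR j) x); lra. }
  lra.
Qed.

Lemma sin_half_lower dl y : 0 < dl -> dl < y -> y < 2 * PI - dl ->
  sin (dl / 2) <= sin (y / 2).
Proof.
  intros H1 H2 H3; pose proof PI_RGT_0.
  destruct (Rle_dec y PI) as [Hy|Hy].
  - apply sin_incr_1; lra.
  - replace (y / 2) with (PI - (PI - y / 2)) by ring.
    rewrite sin_PI_x; apply sin_incr_1; lra.
Qed.

Definition in_arc (s t th : R) : R :=
  if Rlt_dec s th then if Rle_dec th t then 1 else 0 else 0.

(** For a point of the arc the kernels at all [n] nodes sum to [n^2], and those at nodes outside the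
    arc enlarged by [dl] contribute at most [2 / sin^2 (dl / 2)] each. The kernels at nodes of the
    enlarged arc thus nearly majorise [n^2] times the indicator, and each of them, summed over the
    points, is controlled by the power sums. *)
Lemma arc_upper_bound (ths : list R) (n : nat) (s t dl eta : R) :
  (1 <= n)%nat -> s <= t -> 0 < dl -> dl <= 1 -> t - s + 2 * dl < 2 * PI ->
  (forall m c, (1 <= m < n)%nat -> lsum (fun th => cos (INR m * th + c)) ths <= eta) ->
  INR n * lsum (in_arc s t) ths <=
    INR (length ths) * (2 / Rsqr (sin (dl / 2)))
    + ((t - s + 2 * dl) / (2 * PI) * INR n + 1) * (INR (length ths) + INR n * Rmax 0 eta).
Proof.
  intros Hn Hst Hdl Hdl1 Hlen Hw.
  assert (HnR : 0 < INR n) by (apply lt_0_INR; lia).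
  pose proof PI_RGT_0 as Hpi; pose proof PI2_1 as Hpi2.
  assert (Hsin : 0 < sin (dl / 2)) by (apply sin_gt_0; lra).
  set (q := 2 / Rsqr (sin (dl / 2))).
  (* [INR j <= x] says that the node [phi j] lies in the enlarged arc from [s - dl] to [t + dl]. *)
  set (x := (t - s + 2 * dl) / (2 * PI) * INR n).
  assert (Hq : 0 < q) by (apply Rdiv_lt_0_compat; [lra|now apply Rlt_0_sqr, Rgt_not_eq]).
  assert (Hx : 0 <= x) by (apply Rmult_le_pos; [apply Rdiv_le_0_compat; lra|lra]).
  set (phi := node n (s - dl)).
  set (J := fun j => if Rle_dec (INR j) x then 1 else 0).
  assert (HJ : forall j, 0 <= J j) by (intros j; unfold J; destruct Rle_dec; lra).
  set (K := fun th j => fejer n (th - phi j)).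
  assert (Hpt : forall th, In th ths -> in_arc s t th * (INR n * INR n) <=
    lsum (fun j => J j * K th j) (seq 0 n) + in_arc s t th * (INR n * q)).
  { intros th _; unfold in_arc.
    assert (H0 : 0 <= lsum (fun j => J j * K th j) (seq 0 n)).
    { apply lsum_nonneg; intros; apply Rmult_le_pos; [auto|apply fejer_nonneg]. }
    destruct (Rlt_dec s th) as [Hs|]; [|lra].
    destruct (Rle_dec th t) as [Ht|]; [|lra].
    rewrite !Rmult_1_l, <- (fejer_node_sum n (s - dl) th).
    replace (INR n * q) with (lsum (fun _ : nat => q) (seq 0 n))
      by (rewrite lsum_const, length_seq; auto).
    rewrite <- lsum_plus.
    apply lsum_le; intros j Hj; apply in_seq in Hj; fold (phi j) (K th j); unfold J.
    destruct (Rle_dec (INR j) x) as [Hjx|Hjx]; [lra|].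
    assert (Hj' : INR j < INR n) by (apply lt_INR; lia).
    (* A node outside the enlarged arc lies strictly between [t + dl] and [s - dl + 2 PI], hence
       farther than [dl] from [th] modulo [2 PI]. *)
    assert (H1 : t + dl < phi j).
    { unfold phi, node; apply Rnot_le_lt in Hjx; unfold x in Hjx.
      assert ((t - s + 2 * dl) < 2 * PI * INR j / INR n); [|lra].
      apply Rlt_div_r; [lra|].
      apply Rmult_lt_reg_r with (/ (2 * PI)); [apply Rinv_0_lt_compat; lra|].
      replace (2 * PI * INR j * / (2 * PI)) with (INR j) by (field; lra).
      unfold Rdiv in Hjx; lra. }
    assert (H2 : phi j < s - dl + 2 * PI).
    { unfold phi, node.
      assert (2 * PI * INR j / INR n < 2 * PI); [|lra].
      apply Rlt_div_l; [lra|]; nra. }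
    assert (H3 : sin (dl / 2) <= sin ((phi j - th) / 2)) by (apply sin_half_lower; lra).
    pose proof (fejer_decay n (th - phi j)) as H4; fold (K th j) in H4.
    replace ((th - phi j) / 2) with (- ((phi j - th) / 2)) in H4 by lra.
    rewrite sin_neg, <- Rsqr_neg in H4.
    assert (H5 : Rsqr (sin (dl / 2)) <= Rsqr (sin ((phi j - th) / 2))) by (apply Rsqr_incr_1; lra).
    assert (H6 : 0 <= K th j) by apply fejer_nonneg.
    assert (K th j <= q); [|lra].
    unfold q; apply Rle_div_r; [now apply Rlt_0_sqr, Rgt_not_eq|]; nra. }
  apply lsum_le in Hpt.
  rewrite lsum_plus, lsum_swap in Hpt.
  rewrite (lsum_ext (fun th => in_arc s t th * (INR n * INR n))
     (fun th => (INR n * INR n) * in_arc s t th)) in Hpt by (intros; ring).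
  rewrite (lsum_ext (fun th => in_arc s t th * (INR n * q))
     (fun th => (INR n * q) * in_arc s t th)) in Hpt by (intros; ring).
  rewrite !lsum_scal in Hpt.
  set (NN := INR (length ths)) in *.
  set (CC := lsum (in_arc s t) ths) in *.
  assert (HC : CC <= NN).
  { replace NN with (NN * 1) by ring; unfold NN, CC; rewrite <- lsum_const; apply lsum_le.
    intros th _; unfold in_arc; destruct (Rlt_dec s th); [destruct (Rle_dec th t)|]; lra. }
  set (W := NN + INR n * Rmax 0 eta).
  assert (HW : 0 <= W).
  { unfold W, NN; pose proof (pos_INR (length ths)); pose proof (Rmax_l 0 eta); nra. }
  assert (HJK : lsum (fun j => lsum (fun th => J j * K th j) ths) (seq 0 n) <= (x + 1) * (INR n * W)).
  { apply Rle_trans with (lsum (fun j => (INR n * W) * J j) (seq 0 n)).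
    - apply lsum_le; intros j _; rewrite lsum_scal, Rmult_comm; apply Rmult_le_compat_r; auto.
      eapply Rle_trans; [apply (fejer_weyl_sum n ths eta (phi j) Hw)|].
      unfold W, NN; lra.
    - rewrite lsum_scal, Rmult_comm; apply Rmult_le_compat_r; [nra|].
      now apply count_below. }
  apply Rmult_le_reg_l with (INR n); auto.
  assert (INR n * q * CC <= INR n * q * NN) by (apply Rmult_le_compat_l; nra).
  lra.
Qed.

(** * Products over the zeros *)

Definition lprod {A : Type} (f : A -> R) (l : list A) : R :=
  fold_right (fun x p => f x * p) 1 l.

Lemma lprod_cons {A} (f : A -> R) x l : lprod f (x :: l) = f x * lprod f l.
Proof. reflexivity. Qed.

Lemma lprod_ext {A} (f g : A -> R) l : (forall x, f x = g x) -> lprod f l = lprod g l.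
Proof. intros H; induction l as [|x l IH]; simpl; auto. now rewrite H, IH. Qed.

Lemma lprod_nonneg {A} (f : A -> R) l : (forall x, In x l -> 0 <= f x) -> 0 <= lprod f l.
Proof.
  induction l as [|x l IH]; simpl; intros H; [lra|].
  apply Rmult_le_pos; auto.
Qed.

Lemma lprod_pos {A} (f : A -> R) l : (forall x, In x l -> 0 < f x) -> 0 < lprod f l.
Proof.
  induction l as [|x l IH]; simpl; intros H; [lra|].
  apply Rmult_lt_0_compat; auto.
Qed.

Lemma lprod_le {A} (f g : A -> R) l :
  (forall x, In x l -> 0 <= f x <= g x) -> lprod f l <= lprod g l.
Proof.
  induction l as [|x l IH]; simpl; intros H; [lra|].
  apply Rmult_le_compat; auto; try (apply H; auto).
  apply lprod_nonneg; intros; apply H; auto.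
Qed.

Lemma lprod_mult {A} (f g : A -> R) l :
  lprod (fun x => f x * g x) l = lprod f l * lprod g l.
Proof. induction l as [|x l IH]; simpl; [ring|rewrite IH; ring]. Qed.

Lemma lprod_const {A} (c : R) (l : list A) : lprod (fun _ => c) l = c ^ length l.
Proof. induction l as [|x l IH]; simpl; [auto|now rewrite IH]. Qed.

Lemma lprod_map {A B} (g : A -> B) (f : B -> R) l :
  lprod f (map g l) = lprod (fun x => f (g x)) l.
Proof. induction l as [|x l IH]; simpl; auto. now rewrite IH. Qed.

Lemma ln_lprod {A} (f : A -> R) l :
  (forall x, In x l -> 0 < f x) -> ln (lprod f l) = lsum (fun x => ln (f x)) l.
Proof.
  induction l as [|x l IH]; simpl; intros H; [apply ln_1|].
  rewrite ln_mult, IH; auto. apply lprod_pos; auto.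
Qed.

(** * Polynomials on the unit circle and on the circle of radius 1/2 *)

(* Real and imaginary parts, in polar coordinates, of complex polynomials of degree at most [N]. *)
Inductive polar_poly (N : nat) : (R -> R -> R) -> (R -> R -> R) -> Prop :=
| polar_mono n k c : (n <= N)%nat ->
    polar_poly N (fun r phi => k * r ^ n * cos (INR n * phi + c))
                 (fun r phi => k * r ^ n * sin (INR n * phi + c))
| polar_add F1 F2 H1 H2 : polar_poly N F1 F2 -> polar_poly N H1 H2 ->
    polar_poly N (fun r phi => F1 r phi + H1 r phi) (fun r phi => F2 r phi + H2 r phi)
| polar_ext F1 F2 H1 H2 : polar_poly N F1 F2 ->
    (forall r phi, F1 r phi = H1 r phi) -> (forall r phi, F2 r phi = H2 r phi) ->
    polar_poly N H1 H2.

(** Multiplication by [z - e^(i th)] sends a monomial to one of degree [n + 1] with the same phase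
    and one of degree [n] with coefficient [- k] and phase [c + th]. *)
Lemma polar_poly_mul_linear N F1 F2 th : polar_poly N F1 F2 ->
  polar_poly (S N)
    (fun r phi => (r * cos phi - cos th) * F1 r phi - (r * sin phi - sin th) * F2 r phi)
    (fun r phi => (r * cos phi - cos th) * F2 r phi + (r * sin phi - sin th) * F1 r phi).
Proof.
  intros H; induction H as [n k c Hn|F1 F2 H1 H2 _ IH1 _ IH2|F1 F2 H1 H2 _ IH E1 E2].
  - eapply polar_ext.
    + apply polar_add.
      * apply (polar_mono (S N) (S n) k c); lia.
      * apply (polar_mono (S N) n (- k) (c + th)); lia.
    + intros r phi; cbv beta; rewrite S_INR.
      replace ((INR n + 1) * phi + c) with ((INR n * phi + c) + phi) by ring.
      rewrite <- Rplus_assoc; generalize (INR n * phi + c) as u; intros u.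
      rewrite !cos_plus; simpl; ring.
    + intros r phi; cbv beta; rewrite S_INR.
      replace ((INR n + 1) * phi + c) with ((INR n * phi + c) + phi) by ring.
      rewrite <- Rplus_assoc; generalize (INR n * phi + c) as u; intros u.
      rewrite !sin_plus; simpl; ring.
  - eapply polar_ext; [apply (polar_add _ _ _ _ _ IH1 IH2)| |]; intros; cbv beta; ring.
  - eapply polar_ext; [apply IH| |]; intros; cbv beta; now rewrite E1, E2.
Qed.

(* Truncated Poisson kernel at radius 1/2. *)
Definition half_kernel (N : nat) (x : R) : R :=
  1 + lsum (fun l => 2 * (/ 2) ^ S l * cos (INR (S l) * x)) (seq 0 N).

Lemma half_kernel_bound N x : Rabs (half_kernel N x) <= 3.
Proof.
  unfold half_kernel; eapply Rle_trans; [apply Rabs_triang|].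
  rewrite Rabs_R1.
  assert (H : lsum (fun l => Rabs (2 * (/ 2) ^ S l * cos (INR (S l) * x))) (seq 0 N)
    <= lsum (fun l => (/ 2) ^ l) (seq 0 N)).
  { apply lsum_le; intros l _.
    replace (2 * (/ 2) ^ S l) with ((/ 2) ^ l) by (simpl; field).
    assert (0 < (/ 2) ^ l) by (apply pow_lt; lra).
    rewrite Rabs_mult, (Rabs_right ((/ 2) ^ l)) by lra.
    pose proof (COS_bound (INR (S l) * x)) as Hc.
    assert (Rabs (cos (INR (S l) * x)) <= 1) by (apply Rabs_le; lra).
    nra. }
  assert (E : lsum (fun l => (/ 2) ^ l) (seq 0 N) = 2 - 2 * (/ 2) ^ N).
  { clear H; induction N as [|N IH]; [simpl; lra|rewrite lsum_seq_S, IH; simpl; field]. }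
  assert (0 < (/ 2) ^ N) by (apply pow_lt; lra).
  pose proof (Rabs_lsum_le (fun l => 2 * (/ 2) ^ S l * cos (INR (S l) * x)) (seq 0 N)).
  lra.
Qed.

(** Averaging against the kernel multiplies the frequency [n] by [2^(-n)], its value at radius 1/2;
    [n + l <= 2 N] rules out aliasing on [2 N + 1] nodes. *)
Lemma half_kernel_reproduces N n c phi : (n <= N)%nat ->
  lsum (fun j => half_kernel N (node (2 * N + 1) 0 j - phi)
          * cos (INR n * node (2 * N + 1) 0 j + c)) (seq 0 (2 * N + 1))
  = INR (2 * N + 1) * ((/ 2) ^ n * cos (INR n * phi + c)).
Proof.
  intros Hn; set (M := (2 * N + 1)%nat); set (x := node M 0).
  unfold half_kernel.
  rewrite (lsum_ext _ (fun j => cos (INR n * x j + c) + lsum (fun l => 2 * (/ 2) ^ S l *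
    (cos (INR n * x j + c) * cos (INR (S l) * (x j - phi)))) (seq 0 N))).
  2:{ intros j _; fold (x j); rewrite Rmult_plus_distr_r, Rmult_1_l; f_equal.
      rewrite Rmult_comm, <- lsum_scal; apply lsum_ext; intros; ring. }
  rewrite lsum_plus, lsum_swap.
  rewrite (lsum_ext (fun l => lsum _ (seq 0 M)) (fun l => if Nat.eqb n (S l) then
     INR M * ((/ 2) ^ n * cos (INR n * phi + c)) else 0)).
  2:{ intros l Hl; apply in_seq in Hl; rewrite lsum_scal; unfold x.
      rewrite node_cos_product by lia.
      destruct (Nat.eqb_spec n (S l)) as [->|]; [field|ring]. }
  destruct n as [|n].
  - rewrite (lsum_ext (fun l => if Nat.eqb 0 (S l) then _ else _) (fun _ => 0)) by auto.
    rewrite (lsum_ext (fun j => cos (INR 0 * x j + c)) (fun _ => cos (INR 0 * phi + c))).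
    + rewrite !lsum_const, !length_seq; simpl; ring.
    + intros; f_equal; simpl; ring.
  - unfold x; rewrite node_cos_sum by lia; cbn [Nat.eqb].
    rewrite (lsum_indicator (fun _ => INR M * ((/ 2) ^ S n * cos (INR (S n) * phi + c))) n N) by lia.
    ring.
Qed.

Lemma polar_poly_half N F1 F2 phi : polar_poly N F1 F2 ->
  lsum (fun j => half_kernel N (node (2 * N + 1) 0 j - phi)
          * F1 1 (node (2 * N + 1) 0 j)) (seq 0 (2 * N + 1))
    = INR (2 * N + 1) * F1 (/ 2) phi /\
  lsum (fun j => half_kernel N (node (2 * N + 1) 0 j - phi)
          * F2 1 (node (2 * N + 1) 0 j)) (seq 0 (2 * N + 1))
    = INR (2 * N + 1) * F2 (/ 2) phi.
Proof.
  intros H; induction H as [n k c Hn|F1 F2 H1 H2 _ [IH1 IH1'] _ [IH2 IH2']|F1 F2 H1 H2 _ [IH IH'] E1 E2].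
  - assert (Es : forall u, sin (u + c) = cos (u + (c - PI / 2))).
    { intros u; rewrite <- cos_shift, <- cos_neg; f_equal; ring. }
    split.
    + rewrite (lsum_ext _ (fun j => k * (half_kernel N (node (2 * N + 1) 0 j - phi)
          * cos (INR n * node (2 * N + 1) 0 j + c)))).
      * rewrite lsum_scal, half_kernel_reproduces by auto; ring.
      * intros; rewrite pow1; ring.
    + rewrite (lsum_ext _ (fun j => k * (half_kernel N (node (2 * N + 1) 0 j - phi)
          * cos (INR n * node (2 * N + 1) 0 j + (c - PI / 2))))).
      * rewrite lsum_scal, half_kernel_reproduces by auto; rewrite Es; ring.
      * intros; rewrite pow1, Es; ring.
  - split.
    + rewrite Rmult_plus_distr_l, <- IH1, <- IH2, <- lsum_plus; apply lsum_ext; intros; ring.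
    + rewrite Rmult_plus_distr_l, <- IH1', <- IH2', <- lsum_plus; apply lsum_ext; intros; ring.
  - split.
    + rewrite <- E1, <- IH; apply lsum_ext; intros; now rewrite E1.
    + rewrite <- E2, <- IH'; apply lsum_ext; intros; now rewrite E2.
Qed.

(** Takes the place of the maximum principle; the factor 3, the bound on the kernel, disappears in
    [exp (o(N))]. *)
Lemma half_average_bound N (f : R -> R) (y phi B : R) :
  (forall x, Rabs (f x) <= B) ->
  lsum (fun j => half_kernel N (node (2 * N + 1) 0 j - phi)
          * f (node (2 * N + 1) 0 j)) (seq 0 (2 * N + 1)) = INR (2 * N + 1) * y ->
  Rabs y <= 3 * B.
Proof.
  intros HB E; set (M := (2 * N + 1)%nat) in *.
  assert (HM : 0 < INR M) by (apply lt_0_INR; unfold M; lia).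
  apply Rmult_le_reg_l with (INR M); auto.
  rewrite <- (Rabs_right (INR M)) at 1 by lra.
  rewrite <- Rabs_mult, <- E.
  eapply Rle_trans; [apply Rabs_lsum_le|].
  apply Rle_trans with (lsum (fun j : nat => 3 * B) (seq 0 M)).
  - apply lsum_le; intros j _; rewrite Rabs_mult.
    apply Rmult_le_compat; auto using Rabs_pos, half_kernel_bound.
  - rewrite lsum_const, length_seq; lra.
Qed.

(** [F1 + i F2] is [prod (z - e^(i th))] at [z = r e^(i phi)], and the factors on the right are
    [|z - e^(i th)|^2]. *)
Lemma unit_product_polar (ths : list R) : exists F1 F2, polar_poly (length ths) F1 F2 /\
  forall r phi, Rsqr (F1 r phi) + Rsqr (F2 r phi) =
    lprod (fun th => r ^ 2 + 1 - 2 * r * cos (phi - th)) ths.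
Proof.
  induction ths as [|th ths (F1 & F2 & HF & E)].
  - exists (fun r phi => 1 * r ^ 0 * cos (INR 0 * phi + 0)),
      (fun r phi => 1 * r ^ 0 * sin (INR 0 * phi + 0)); split; [apply (polar_mono 0); lia|].
    intros; simpl; rewrite Rmult_0_l, Rplus_0_l, cos_0, sin_0; unfold Rsqr; ring.
  - do 2 eexists; split; [apply (polar_poly_mul_linear _ _ _ th HF)|].
    intros r phi; rewrite lprod_cons, <- E, cos_minus; unfold Rsqr.
    pose proof (sin2_cos2 phi) as H1; pose proof (sin2_cos2 th) as H2; unfold Rsqr in H1, H2.
    set (p := cos phi) in *; set (q := sin phi) in *; set (u := cos th) in *; set (v := sin th) in *.
    set (x := F1 r phi); set (y := F2 r phi).
    replace (r ^ 2 + 1 - 2 * r * (p * u + q * v)) with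
      ((r * p - u) * (r * p - u) + (r * q - v) * (r * q - v)); [ring|].
    replace (r ^ 2) with (r * r * (q * q + p * p)) by (rewrite H1; ring).
    rewrite <- H2; ring.
Qed.

(** The real and imaginary parts are each at most [3 B] at radius 1/2, whence [18 = 2 * 3^2]. *)
Lemma unit_product_half (ths : list R) (B : R) : 0 <= B ->
  (forall phi, lprod (fun th => 2 - 2 * cos (phi - th)) ths <= Rsqr B) ->
  forall phi, lprod (fun th => 5 / 4 - cos (phi - th)) ths <= 18 * Rsqr B.
Proof.
  intros HB H phi.
  destruct (unit_product_polar ths) as (F1 & F2 & HF & E).
  assert (Hb : forall x, Rabs (F1 1 x) <= B /\ Rabs (F2 1 x) <= B).
  { intros x; specialize (H x).
    assert (E1 : Rsqr (F1 1 x) + Rsqr (F2 1 x) <= Rsqr B).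
    { rewrite E; eapply Rle_trans; [|apply H]; right.
      apply lprod_ext; intros; ring. }
    pose proof (Rle_0_sqr (F1 1 x)); pose proof (Rle_0_sqr (F2 1 x)).
    rewrite <- (Rabs_right B) by lra; split; apply Rsqr_le_abs_0; lra. }
  destruct (polar_poly_half _ _ _ phi HF) as [H1 H2].
  apply (half_average_bound _ (F1 1) _ _ B) in H1; [|apply Hb].
  apply (half_average_bound _ (F2 1) _ _ B) in H2; [|apply Hb].
  apply Rle_trans with (Rsqr (F1 (/ 2) phi) + Rsqr (F2 (/ 2) phi)).
  - rewrite E; right; apply lprod_ext; intros; field.
  - assert (Hs : forall z, Rabs z <= 3 * B -> Rsqr z <= 9 * Rsqr B).
    { intros z Hz; replace (9 * Rsqr B) with (Rsqr (3 * B)) by (unfold Rsqr; ring).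
      apply Rsqr_le_abs_1; rewrite (Rabs_right (3 * B)); lra. }
    apply Hs in H1, H2; lra.
Qed.

(** * The zeros of [G] *)

Lemma Rsqr_Cmod (z : C) : Rsqr (Cmod z) = Rsqr (Re z) + Rsqr (Im z).
Proof.
  unfold Cmod; rewrite Rsqr_sqrt; [unfold Rsqr, Re, Im; ring|].
  apply Rplus_le_le_0_compat; apply pow2_ge_0.
Qed.

Lemma Arg_polar (z : C) : z <> RtoC 0 ->
  Re z = Cmod z * cos (Arg z) /\ Im z = Cmod z * sin (Arg z) /\ - PI < Arg z <= PI.
Proof.
  intros Hz; apply Cmod_gt_0 in Hz.
  pose proof (Rsqr_Cmod z) as E; set (rho := Cmod z) in *; unfold Rsqr in E.
  set (x := Re z / rho).
  assert (Ex : Re z = rho * x) by (unfold x; field; lra).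
  assert (Hx : -1 <= x <= 1).
  { assert (Hxx : x * x <= 1).
    { apply Rmult_le_reg_l with (rho * rho); [nra|].
      rewrite Ex in E; pose proof (Rle_0_sqr (Im z)) as Hi; unfold Rsqr in Hi; lra. }
    split; nra. }
  assert (Hs : sqrt (1 - Rsqr x) = Rabs (Im z) / rho).
  { rewrite <- (sqrt_Rsqr (Rabs (Im z) / rho)).
    - f_equal; unfold Rdiv; rewrite Rsqr_mult, <- Rsqr_abs.
      rewrite Ex in E; unfold Rsqr.
      replace (Im z * Im z) with (rho * rho * (1 - x * x)) by lra; field; lra.
    - apply Rdiv_le_0_compat; [apply Rabs_pos|lra]. }
  pose proof (acos_bound x) as Hb; pose proof PI_RGT_0.
  unfold Arg; fold rho x; destruct (Rle_dec 0 (Im z)) as [Hi|Hi].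
  - rewrite cos_acos, sin_acos, Hs, Rabs_right by lra.
    repeat split; try lra; field; lra.
  - apply Rnot_le_lt in Hi.
    rewrite cos_neg, sin_neg, cos_acos, sin_acos, Hs, Rabs_left by lra.
    repeat split; try lra; [field; lra|].
    (* The value [PI] would force [x = -1] and so [Im z = 0], whereas here [Im z < 0]. *)
    assert (acos x <> PI); [|lra].
    intros Ea; assert (Ec : cos (acos x) = -1) by (rewrite Ea; apply cos_PI).
    rewrite cos_acos in Ec by lra; rewrite Ex, Ec in E; nra.
Qed.

Lemma Cmod_Cpow z n : Cmod (Cpow z n) = Cmod z ^ n.
Proof. induction n as [|n IH]; simpl; [apply Cmod_1|now rewrite Cmod_mult, IH]. Qed.

Lemma Cmod_Cprod_lin ts z : Cmod (Cprod_lin ts z) = lprod (fun t => Cmod (Cminus z t)) ts.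
Proof. induction ts as [|t ts IH]; simpl; [apply Cmod_1|now rewrite Cmod_mult, IH]. Qed.

Lemma Aplus_nonneg d n a : 0 < a -> 0 <= Aplus d n a.
Proof.
  intros Ha; rewrite Aplus_lsum; apply lsum_nonneg; intros; apply Rlt_le, weight_pos; auto.
Qed.

Lemma Cmod_G_le d a N z : 0 < a ->
  Cmod (G d a N z) <= lsum (fun n => Aplus d n a * Cmod z ^ n) (seq 0 (S N)).
Proof.
  intros Ha; induction N as [|N IH].
  - simpl; rewrite Cmod_R, Rabs_right by (apply Rle_ge, Aplus_nonneg; auto); lra.
  - rewrite lsum_seq_S; cbn [G]; eapply Rle_trans; [apply Cmod_triangle|].
    apply Rplus_le_compat; auto.
    rewrite Cmod_mult, Cmod_R, Cmod_Cpow, Rabs_right by (apply Rle_ge, Aplus_nonneg; auto); lra.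
Qed.

Lemma G_at_0 d a N : G d a N (RtoC 0) = RtoC 1.
Proof.
  induction N as [|N IH]; simpl; [now rewrite Aplus_0|].
  rewrite IH, Cmult_0_l, Cmult_0_r, Cplus_0_r; auto.
Qed.

(** The right side exceeds the left by exactly [(r - Cmod t)^2]. *)
Lemma schur_factor (t : C) (r phi : R) : t <> RtoC 0 -> 0 < r ->
  r * Cmod t * (2 - 2 * cos (phi - Arg t)) <=
  Rsqr (Cmod (Cminus (r * cos phi, r * sin phi) t)).
Proof.
  intros Ht Hr; destruct (Arg_polar t Ht) as (E1 & E2 & _).
  rewrite Rsqr_Cmod; unfold Cminus, Cplus, Copp, Re, Im in *; simpl.
  rewrite E1, E2, cos_minus; unfold Rsqr.
  set (rho := Cmod t).
  pose proof (sin2_cos2 phi) as H1; pose proof (sin2_cos2 (Arg t)) as H2; unfold Rsqr in H1, H2.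
  set (p := cos phi) in *; set (q := sin phi) in *.
  set (u := cos (Arg t)) in *; set (v := sin (Arg t)) in *.
  replace ((r * p + - (rho * u)) * (r * p + - (rho * u)) + (r * q + - (rho * v)) * (r * q + - (rho * v)))
    with (r * r * (q * q + p * p) + rho * rho * (v * v + u * u) - 2 * r * rho * (p * u + q * v)) by ring.
  rewrite H1, H2; pose proof (Rle_0_sqr (r - rho)) as H; unfold Rsqr in H; lra.
Qed.

(* Schur: moving all zeros radially to the circle of radius [r] decreases the modulus on that circle, after normalisation by the extreme coefficients. *)
Lemma zeros_unit_product d a N ts r : 0 < a -> 0 < r -> 0 < Aplus d N a -> length ts = N ->
  (forall t : C, G d a N t = Cmult (RtoC (Aplus d N a)) (Cprod_lin ts t)) ->
  (forall t, In t ts -> t <> RtoC 0) /\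
  forall phi, lprod (fun th => 2 - 2 * cos (phi - th)) (map Arg ts) <=
    Rsqr (lsum (fun n => Aplus d n a * r ^ n) (seq 0 (S N))) / (Aplus d N a * r ^ N).
Proof.
  intros Ha Hr HA Hl HG; set (AN := Aplus d N a) in *.
  (* Evaluation at 0, where [G] is [A_0 = 1], makes the product of the moduli [/ AN] and keeps the
     zeros away from 0. *)
  assert (H0 : 1 = AN * lprod Cmod ts).
  { assert (E := f_equal Cmod (HG (RtoC 0))).
    rewrite G_at_0, Cmod_mult, Cmod_1, Cmod_R, Rabs_right, Cmod_Cprod_lin in E by lra.
    rewrite E; f_equal; clear; induction ts as [|t ts IH]; simpl; auto.
    rewrite IH; f_equal; rewrite <- Cmod_opp; f_equal; unfold Cminus; ring. }
  assert (Hnz : forall t, In t ts -> t <> RtoC 0).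
  { intros t Ht ->.
    assert (E : lprod Cmod ts = 0); [|rewrite E in H0; lra].
    clear - Ht; induction ts as [|t ts IH]; simpl in *; [contradiction|].
    destruct Ht as [->|Ht]; [rewrite Cmod_0; ring|rewrite IH by auto; ring]. }
  split; auto; intros phi; rewrite lprod_map.
  set (V := lsum (fun n => Aplus d n a * r ^ n) (seq 0 (S N))).
  set (z := (r * cos phi, r * sin phi) : C).
  assert (Hz : Cmod z = r).
  { unfold Cmod, z; simpl fst; simpl snd.
    replace ((r * cos phi) ^ 2 + (r * sin phi) ^ 2) with (Rsqr r * (Rsqr (sin phi) + Rsqr (cos phi)))
      by (unfold Rsqr; ring).
    rewrite sin2_cos2, Rmult_1_r; apply sqrt_Rsqr; lra. }
  assert (HV : AN * lprod (fun t => Cmod (Cminus z t)) ts <= V).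
  { pose proof (Cmod_G_le d a N z Ha) as H; rewrite HG, Cmod_mult, Cmod_R, Rabs_right, Cmod_Cprod_lin, Hz in H by lra.
    exact H. }
  set (Pz := lprod (fun t => Cmod (Cminus z t)) ts) in *.
  assert (HP0 : 0 <= Pz) by (apply lprod_nonneg; intros; apply Cmod_ge_0).
  set (Q := lprod (fun t => 2 - 2 * cos (phi - Arg t)) ts).
  assert (Hschur : r ^ N * lprod Cmod ts * Q <= Pz * Pz).
  { rewrite <- Hl, <- (lprod_const r ts); unfold Q, Pz; rewrite <- !lprod_mult.
    apply lprod_le; intros t Ht; pose proof (schur_factor t r phi (Hnz t Ht) Hr) as H.
    fold z in H; unfold Rsqr in H; split; auto.
    repeat apply Rmult_le_pos; try lra; [apply Cmod_ge_0|].
    pose proof (COS_bound (phi - Arg t)); lra. }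
  assert (Hrn : 0 < r ^ N) by (now apply pow_lt).
  apply Rle_div_r; [apply Rmult_lt_0_compat; auto|].
  assert (Hpp : lprod Cmod ts = / AN).
  { apply Rmult_eq_reg_l with AN; [|lra]; rewrite <- H0; field; lra. }
  rewrite Hpp in Hschur.
  apply Rle_trans with (Rsqr (AN * Pz)).
  - replace (Q * (AN * r ^ N)) with (AN * AN * (r ^ N * / AN * Q)) by (field; lra).
    replace (Rsqr (AN * Pz)) with (AN * AN * (Pz * Pz)) by (unfold Rsqr; ring).
    apply Rmult_le_compat_l; [nra|auto].
  - apply Rsqr_incr_1; auto; [nra|].
    eapply Rle_trans; [|apply HV]; nra.
Qed.

(** With [e = beta / 4], the coefficient sum is at most [C2 exp (2 e N)] and the divisor at least
    [exp (- e N)], so Schur's bound is [C2^2 exp (5 e N)]. The constant [18 C2^2] is absorbed by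
    [exp (3 e N)]; the total [8 e = 2 beta] is halved by the [/ 2] before the logarithm. *)
Lemma zeros_potential d a beta : (2 <= d)%nat -> 0 < a -> 0 < beta ->
  exists N1, forall N, (1 <= N)%nat -> (N1 <= N)%nat -> forall ts, length ts = N ->
  (forall t : C, G d a N t = Cmult (RtoC (Aplus d N a)) (Cprod_lin ts t)) ->
  (forall t, In t ts -> t <> RtoC 0) /\
  forall phi, lsum (fun th => / 2 * ln (5 / 4 - cos (phi - th))) (map Arg ts) <= beta * INR N.
Proof.
  intros Hd Ha Hb.
  destruct (Aplus_growth d a Hd Ha) as [gamma Hg].
  set (e := beta / 4); assert (He : 0 < e) by (unfold e; lra).
  destruct (Hg e He) as [n0 Hn0].
  set (r := exp (- gamma)); assert (Hr : 0 < r) by apply exp_pos.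
  assert (Hrn : forall n, r ^ n = exp (- gamma * INR n)).
  { intros n; induction n as [|n IH]; [simpl; now rewrite Rmult_0_r, exp_0|].
    rewrite S_INR, Rmult_plus_distr_l, exp_plus, <- IH, Rmult_1_r; simpl; unfold r; ring. }
  (* The growth estimate says nothing below [n0]; each of those terms is at most their sum [C0]. *)
  set (C0 := lsum (fun n => Aplus d n a * r ^ n) (seq 0 n0)).
  assert (Hterm0 : forall n, 0 <= Aplus d n a * r ^ n).
  { intros n; apply Rmult_le_pos; [now apply Aplus_nonneg|apply pow_le; lra]. }
  assert (HC0 : 0 <= C0) by (apply lsum_nonneg; auto).
  assert (Hterm : forall n N, (n <= N)%nat -> Aplus d n a * r ^ n <= (1 + C0) * exp (e * INR N)).
  { intros n N HnN.
    assert (Hexp : 1 <= exp (e * INR N)).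
    { rewrite <- exp_0; apply exp_le_compat; pose proof (pos_INR N); nra. }
    destruct (le_lt_dec n0 n) as [Hge|Hlt].
    - destruct (Hn0 n Hge) as [_ H]; rewrite Hrn.
      apply Rle_trans with (exp (e * INR N)); [|nra].
      apply Rle_trans with (exp ((gamma + e) * INR n) * exp (- gamma * INR n)).
      + apply Rmult_le_compat_r; [apply Rlt_le, exp_pos|auto].
      + rewrite <- exp_plus; apply exp_le_compat; apply le_INR in HnN; nra.
    - apply Rle_trans with C0; [|nra].
      unfold C0; rewrite <- (lsum_indicator (fun n => Aplus d n a * r ^ n) n n0) by auto.
      apply lsum_le; intros i _; destruct (Nat.eqb n i); auto; lra. }
  set (C2 := (1 + C0) * (1 + / e)).
  assert (Hie : 0 < / e) by (now apply Rinv_0_lt_compat).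
  assert (HV : forall N, lsum (fun n => Aplus d n a * r ^ n) (seq 0 (S N)) <= C2 * exp (2 * e * INR N)).
  { intros N; apply Rle_trans with (INR (S N) * ((1 + C0) * exp (e * INR N))).
    - rewrite <- (length_seq (S N) 0) at 2; rewrite <- lsum_const; apply lsum_le.
      intros n Hn; apply in_seq in Hn; apply Hterm; lia.
    (* The number of terms is absorbed by another [exp (e N)], through [1 + x <= exp x]. *)
    - assert (Hs : INR (S N) <= (1 + / e) * exp (e * INR N)).
      { pose proof (exp_ineq1_le (e * INR N)); pose proof (pos_INR N).
        rewrite S_INR; apply Rle_trans with ((1 + / e) * (1 + e * INR N)); [|nra].
        replace ((1 + / e) * (1 + e * INR N)) with (1 + e * INR N + / e + INR N) by (field; lra).
        nra. }
      replace (2 * e * INR N) with (e * INR N + e * INR N) by ring; rewrite exp_plus.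
      unfold C2; assert (0 < (1 + C0) * exp (e * INR N)) by (apply Rmult_lt_0_compat; [lra|apply exp_pos]).
      apply Rle_trans with ((1 + / e) * exp (e * INR N) * ((1 + C0) * exp (e * INR N))); [nra|right; ring]. }
  assert (HC2 : 0 < C2) by (unfold C2; apply Rmult_lt_0_compat; lra).
  destruct (nat_ge_R (18 * Rsqr C2 / (3 * e))) as [n1 Hn1].
  exists (n0 + n1)%nat; intros N HN1 HN ts Hl HG.
  specialize (Hn1 N ltac:(lia)); destruct (Hn0 N ltac:(lia)) as [HAN _].
  assert (HANpos : 0 < Aplus d N a) by (eapply Rlt_le_trans; [apply exp_pos|apply HAN]).
  destruct (zeros_unit_product d a N ts r Ha Hr HANpos Hl HG) as [Hnz Hprod].
  split; auto; intros phi.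
  set (V := lsum (fun n => Aplus d n a * r ^ n) (seq 0 (S N))) in *.
  assert (HV0 : 0 <= V) by (apply lsum_nonneg; auto).
  specialize (HV N); fold V in HV.
  assert (HAr : exp (- e * INR N) <= Aplus d N a * r ^ N).
  { rewrite Hrn; apply Rle_trans with (exp ((gamma - e) * INR N) * exp (- gamma * INR N)).
    - rewrite <- exp_plus; right; f_equal; ring.
    - apply Rmult_le_compat_r; [apply Rlt_le, exp_pos|auto]. }
  set (B := C2 * exp (5 / 2 * e * INR N)).
  assert (HBpos : 0 < B) by (apply Rmult_lt_0_compat; [auto|apply exp_pos]).
  assert (HB2 : Rsqr V / (Aplus d N a * r ^ N) <= Rsqr B).
  { apply Rle_div_l; [eapply Rlt_le_trans; [apply exp_pos|apply HAr]|].
    apply Rle_trans with (Rsqr (C2 * exp (2 * e * INR N))); [apply Rsqr_incr_1; auto; nra|].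
    apply Rle_trans with (Rsqr B * exp (- e * INR N)).
    - assert (Eexp : exp (2 * e * INR N) * exp (2 * e * INR N) =
        exp (5 / 2 * e * INR N) * exp (5 / 2 * e * INR N) * exp (- e * INR N))
        by (rewrite <- !exp_plus; f_equal; field).
      unfold B, Rsqr; right; transitivity (C2 * C2 * (exp (2 * e * INR N) * exp (2 * e * INR N)));
        [ring|rewrite Eexp; ring].
    - apply Rmult_le_compat_l; [apply Rle_0_sqr|auto]. }
  assert (Hhalf : lprod (fun th => 5 / 4 - cos (phi - th)) (map Arg ts) <= 18 * Rsqr B).
  { apply unit_product_half; [lra|]; intros psi; eapply Rle_trans; [apply Hprod|auto]. }
  assert (Hpos : forall th, In th (map Arg ts) -> 0 < 5 / 4 - cos (phi - th)).
  { intros th _; pose proof (COS_bound (phi - th)); lra. }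
  rewrite lsum_scal, <- ln_lprod by auto.
  assert (Hlp := lprod_pos _ _ Hpos).
  assert (Hln : ln (lprod (fun th => 5 / 4 - cos (phi - th)) (map Arg ts)) <= 2 * beta * INR N).
  { rewrite <- (ln_exp (2 * beta * INR N)); apply ln_le; auto.
    eapply Rle_trans; [apply Hhalf|].
    replace (2 * beta * INR N) with (3 * e * INR N + (5 / 2 * e * INR N + 5 / 2 * e * INR N))
      by (unfold e; field).
    rewrite !exp_plus; unfold B; rewrite Rsqr_mult, <- Rmult_assoc.
    apply Rmult_le_compat_r; [apply Rle_0_sqr|].
    apply (proj1 (Rle_div_l (18 * Rsqr C2) (INR N) (3 * e) ltac:(lra))) in Hn1.
    pose proof (exp_ineq1_le (3 * e * INR N)); lra. }
  lra.
Qed.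

(** * Counting zeros in arcs *)

Lemma alpha_lsum ts s t : INR (alpha ts s t) = lsum (in_arc s t) (map Arg ts).
Proof.
  unfold alpha; rewrite <- (Rmult_1_r (INR _)), <- lsum_const, lsum_filter, lsum_map.
  apply lsum_ext; intros z _; unfold in_arc.
  destruct (Rlt_dec s (Arg z)); auto; destruct (Rle_dec (Arg z) t); auto.
Qed.

(** Every parameter is fixed before [N]: the enlargement [dl], the Fejer order [n], the tolerance
    [kappa] for power sums, the rate [beta] of the potential and the truncation [L]. One [N1] serves
    all arcs. *)
Lemma zeros_arc_upper d a eta : (2 <= d)%nat -> 0 < a -> 0 < eta ->
  exists N1, forall N, (1 <= N)%nat -> (N1 <= N)%nat -> forall ts, length ts = N ->
  (forall t : C, G d a N t = Cmult (RtoC (Aplus d N a)) (Cprod_lin ts t)) ->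
  (forall t, In t ts -> t <> RtoC 0) /\
  forall s t, s <= t ->
    INR (alpha ts s t) <= INR N * ((t - s) / (2 * PI) + eta).
Proof.
  intros Hd Ha Heta.
  pose proof PI_RGT_0 as Hpi; pose proof PI2_1 as Hpi2.
  set (dl := Rmin 1 (eta / 4)).
  assert (Hdl : 0 < dl <= 1 /\ dl <= eta / 4).
  { unfold dl; repeat split; [apply Rmin_glb_lt; lra|apply Rmin_l|apply Rmin_r]. }
  assert (Hsin : 0 < sin (dl / 2)) by (apply sin_gt_0; lra).
  set (q := 2 / Rsqr (sin (dl / 2))).
  assert (Hq : 0 < q) by (apply Rdiv_lt_0_compat; [lra|now apply Rlt_0_sqr, Rgt_not_eq]).
  (* Ensures [q + 1 <= eta * n / 4], covering the kernel tail and the extra node. *)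
  destruct (nat_ge_R (4 * (q + 1) / eta)) as [n' Hn'].
  set (n := S n'); specialize (Hn' n ltac:(unfold n; lia)).
  apply (proj1 (Rle_div_l (4 * (q + 1)) (INR n) eta ltac:(lra))) in Hn'.
  assert (Hn1 : 1 <= INR n) by (apply (le_INR 1); unfold n; lia).
  set (kappa := eta / (8 * INR n)).
  assert (Hk : 0 < kappa) by (apply Rdiv_lt_0_compat; lra).
  set (Z := 2 * INR n * 2 ^ n).
  assert (H2n : 0 < 2 ^ n) by (apply pow_lt; lra).
  assert (HZ : 0 < Z) by (unfold Z; nra).
  (* [Z] bounds the loss [2 m 2^m] for [m < n]; potential and truncation error, each at most
     [beta N], together give [Z * 2 beta N = kappa N]. *)
  set (beta := kappa / (2 * Z)).
  assert (Hbeta : 0 < beta) by (apply Rdiv_lt_0_compat; lra).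
  destruct (pow_lt_1_zero (/ 2) ltac:(rewrite Rabs_right; lra) (beta / 4) ltac:(lra)) as [L0 HL0].
  set (L := (L0 + n)%nat); specialize (HL0 L ltac:(unfold L; lia)).
  rewrite Rabs_right in HL0 by (apply Rle_ge, pow_le; lra).
  destruct (zeros_potential d a beta Hd Ha Hbeta) as [N1 HN1].
  exists N1; intros N H1N HN ts Hl HG.
  destruct (HN1 N H1N HN ts Hl HG) as [Hnz Hpot]; split; auto.
  assert (HNR : 1 <= INR N) by (apply (le_INR 1); lia).
  assert (Hlen : length (map Arg ts) = N) by (now rewrite length_map).
  assert (Hweyl : forall m c, (1 <= m < n)%nat ->
    lsum (fun th => cos (INR m * th + c)) (map Arg ts) <= kappa * INR N).
  { intros m c Hm.
    eapply Rle_trans; [apply (power_sum_bound _ (beta * INR N) m L c); auto; unfold L; lia|].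
    rewrite Hlen.
    assert (Hm' : 0 < INR m <= INR n) by (split; [apply lt_0_INR; lia|apply le_INR; lia]).
    assert (H2m : 0 < 2 ^ m <= 2 ^ n) by (split; [apply pow_lt; lra|apply Rle_pow; [lra|lia]]).
    assert (HmZ : 2 * INR m * 2 ^ m <= Z) by (unfold Z; nra).
    apply Rle_trans with (Z * (2 * beta * INR N)).
    - assert (HpL : 0 < (/ 2) ^ L) by (apply pow_lt; lra).
      assert (HbN : 0 < beta * INR N) by nra.
      assert (HpN : 0 <= 4 * (/ 2) ^ L * INR N) by nra.
      assert (HpbN : 4 * (/ 2) ^ L * INR N <= beta * INR N) by (apply Rmult_le_compat_r; lra).
      apply Rmult_le_compat; [nra|lra|auto|lra].
    - right; unfold beta; field; lra. }
  intros s t Hst; rewrite alpha_lsum.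
  (* If the enlarged arc covers the circle, [(t - s) / (2 PI) >= 1 - eta] and the trivial count [N]
     suffices. *)
  destruct (Rlt_dec (t - s + 2 * dl) (2 * PI)) as [Hlt|Hge].
  - pose proof (arc_upper_bound (map Arg ts) n s t dl (kappa * INR N)
      ltac:(unfold n; lia) Hst ltac:(lra) ltac:(lra) Hlt Hweyl) as H.
    rewrite Hlen in H; fold q in H; rewrite Rmax_right in H by nra.
    set (CC := lsum (in_arc s t) (map Arg ts)) in *.
    set (rho := (t - s + 2 * dl) / (2 * PI)) in *.
    assert (Hrho : 0 <= rho <= 1).
    { unfold rho; split; [apply Rdiv_le_0_compat; lra|apply Rle_div_l; lra]. }
    assert (Hrho' : rho <= (t - s) / (2 * PI) + eta / 4).
    { unfold rho; replace ((t - s + 2 * dl) / (2 * PI)) with ((t - s) / (2 * PI) + dl / PI) by (field; lra).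
      assert (dl / PI <= dl); [|lra]. apply Rle_div_l; nra. }
    assert (Ekn : INR n * kappa = eta / 8) by (unfold kappa; field; lra).
    apply Rmult_le_reg_l with (INR n); [lra|].
    apply Rle_trans with (INR N * (q + (rho * INR n + 1) * (1 + INR n * kappa))).
    + eapply Rle_trans; [apply H|]; right; ring.
    + rewrite Ekn, <- Rmult_assoc, (Rmult_comm (INR n) (INR N)), Rmult_assoc.
      apply Rmult_le_compat_l; [lra|]; nra.
  - apply Rle_trans with (INR N * 1).
    + rewrite <- Hlen, <- lsum_const; apply lsum_le; intros th _; unfold in_arc.
      destruct (Rlt_dec s th); [destruct (Rle_dec th t)|]; lra.
    + apply Rmult_le_compat_l; [lra|].
      assert (1 - eta <= (t - s) / (2 * PI)); [|lra].
      apply Rle_div_r; nra.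
Qed.

(** Arguments of nonzero points lie in the half-open interval from [- PI] to [PI], which the three
    half-open arcs partition; an outer arc may be empty. *)
Lemma alpha_partition ts theta phi : - PI <= theta -> theta < phi -> phi <= PI ->
  (forall t, In t ts -> t <> RtoC 0) ->
  INR (alpha ts (- PI) theta) + INR (alpha ts theta phi) + INR (alpha ts phi PI)
   = INR (length ts).
Proof.
  intros H1 H2 H3 Hnz; rewrite !alpha_lsum, <- !lsum_plus, lsum_map.
  rewrite (lsum_ext _ (fun _ => 1)), lsum_const; [ring|].
  intros z Hz; destruct (Arg_polar z (Hnz z Hz)) as (_ & _ & Hb); unfold in_arc.
  repeat (match goal with |- context [if ?b then _ else _] => destruct b end); lra.
Qed.

Theorem theorem2p4 (d : nat) (a : R) :
  (2 <= d)%nat -> 0 < a ->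
  forall theta phi eps : R,
    -PI <= theta -> theta < phi -> phi <= PI -> 0 < eps ->
    exists N1 : nat, forall N : nat, (1 <= N)%nat -> (N1 <= N)%nat ->
      forall ts : list C,
        length ts = N ->
        (forall t : C, G d a N t = Cmult (RtoC (Aplus d N a)) (Cprod_lin ts t)) ->
        Rsqr (Rabs (INR (alpha ts theta phi) / INR N - (phi - theta) / (2 * PI))) <= eps.
Proof.
  intros Hd Ha theta phi eps H1 H2 H3 He.
  pose proof PI_RGT_0 as Hpi.
  (* The cap at 1 gives [eta^2 <= eta <= eps]. *)
  set (eta := Rmin 1 eps).
  assert (Heta : 0 < eta <= 1 /\ eta <= eps).
  { unfold eta; repeat split; [apply Rmin_glb_lt; lra|apply Rmin_l|apply Rmin_r]. }
  (* The lower bound adds the errors of both outer arcs, hence [eta / 2] for each. *)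
  destruct (zeros_arc_upper d a (eta / 2) Hd Ha ltac:(lra)) as [N1 HN1].
  exists N1; intros N H1N HN ts Hl HG.
  destruct (HN1 N H1N HN ts Hl HG) as [Hnz Harc].
  assert (HNR : 1 <= INR N) by (apply (le_INR 1); lia).
  pose proof (alpha_partition ts theta phi H1 H2 H3 Hnz) as Hsum; rewrite Hl in Hsum.
  pose proof (Harc theta phi ltac:(lra)) as Hmid.
  pose proof (Harc (- PI) theta H1) as Hleft.
  pose proof (Harc phi PI H3) as Hright.
  set (A := INR (alpha ts theta phi)) in *.
  assert (E : (theta - - PI) / (2 * PI) + (phi - theta) / (2 * PI) + (PI - phi) / (2 * PI) = 1)
    by (field; lra).
  set (x := (phi - theta) / (2 * PI)) in *.
  set (y := (theta - - PI) / (2 * PI)) in *; set (w := (PI - phi) / (2 * PI)) in *.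
  assert (Habs : Rabs (A / INR N - x) <= eta).
  { apply Rabs_le; split.
    - assert (x - eta <= A / INR N); [|lra].
      apply Rle_div_r; [lra|]; nra.
    - assert (A / INR N <= x + eta); [|lra].
      apply Rle_div_l; [lra|]; nra. }
  apply Rle_trans with (Rsqr eta); [|unfold Rsqr; nra].
  apply Rsqr_incr_1; auto; [apply Rabs_pos|lra].
Qed.
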